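(* Let $M$ be a left $\Gamma_{\max}$-matroid on $E$, let $e\in E$. Then $\mathcal{V}(M/e) = \mathcal{V}(M)^e$ and $\mathcal{V}(M\setminus e) = \mathcal{V}(M)_e$.
   Context: $\Gamma_{\max}$ is the skew hyperfield on $\Gamma\cup\{0\}$ for a totally ordered group $\Gamma$, with hyperaddition $x\boxplus y=\{\max\{x,y\}\}$ if $x\neq y$, $x\boxplus x=\{z\le x\}\cup\{0\}$. $\mathcal V(M)$ is the set of vectors of $M$: the $V\in\Gamma_{\max}^E$ with $0\in V_{e_1}Y_{e_1}\boxplus\cdots\boxplus V_{e_n}Y_{e_n}$ for all cocircuits $Y$ ($E=\{e_1,\dots,e_n\}$). For $\mathcal Q\subseteq H^E$, $\mathcal Q^e=\{Q\setminus e: Q\in\mathcal Q\}$ and $\mathcal Q_e=\{Q\setminus e:Q\in\mathcal Q, Q_e=0\}$, where $Q\setminus e$ is restriction to $E\setminus e$. The deletion $M\setminus e$ has circuits $\mathcal C(M)_e$; the contraction $M/e$ has circuits the support-minimal nonzero elements of $\mathcal C(M)^e$. *)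

(* Defs.v *)
From HB Require Import structures.
From mathcomp Require Import all_boot all_order.
From mathcomp Require Import boolp classical_sets.

Set Implicit Arguments.
Unset Strict Implicit.
Unset Printing Implicit Defensive.

Import Order.TTheory.

Local Open Scope classical_set_scope.

(* Totally ordered groups. The group need not be abelian, so invariance of the
   order is required on both sides. *)
HB.mixin Record isOrderedGroup (d : Order.disp_t) G
    of monoid.Group G & Order.Total d G := {
  leg_mul2l : forall z x y : G, (x <= y)%O -> ((z * x)%g <= (z * y)%g)%O;
  leg_mul2r : forall z x y : G, (x <= y)%O -> ((x * z)%g <= (y * z)%g)%O
}.

#[short(type="orderedGroupType")]
HB.structure Definition OrderedGroup (d : Order.disp_t) :=
  {G of isOrderedGroup d G & monoid.Group G & Order.Total d G}.

Record skewHyperfield := SkewHyperfield {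
  hcarrier :> choiceType;
  hadd : hcarrier -> hcarrier -> set hcarrier;
  hzero : hcarrier;
  hopp : hcarrier -> hcarrier;
  hmul : hcarrier -> hcarrier -> hcarrier;
  hone : hcarrier;
  hinv : hcarrier -> hcarrier;
  hadd_neq0 : forall x y, hadd x y !=set0;
  haddC : forall x y, hadd x y = hadd y x;
  haddA : forall x y z,
    \bigcup_(t in hadd x y) hadd t z = \bigcup_(t in hadd y z) hadd x t;
  hadd0 : forall x, hadd x hzero = [set x];
  hoppP : forall x y, hadd x y hzero <-> y = hopp x;
  hadd_rev : forall x y z, hadd y z x -> hadd x (hopp y) z;
  hmulA : associative hmul;
  hmul1l : left_id hone hmul;
  hmul1r : right_id hone hmul;
  hmul0l : left_zero hzero hmul;
  hmul0r : right_zero hzero hmul;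
  hmulDl : forall a x y, hmul a @` hadd x y = hadd (hmul a x) (hmul a y);
  hmulDr : forall a x y, hmul^~ a @` hadd x y = hadd (hmul x a) (hmul y a);
  hone_neq0 : hone != hzero;
  hmulV : forall x, x != hzero -> hmul x (hinv x) = hone;
  hmulVl : forall x, x != hzero -> hmul (hinv x) x = hone
}.

(* The carrier of Gamma_max: None is 0, the least element. *)
Definition gmax (d : Order.disp_t) (G : orderedGroupType d) : Type := option G.

Section GmaxOrder.
Variables (d : Order.disp_t) (G : orderedGroupType d).

HB.instance Definition _ := Choice.copy (gmax G) (option G).

Definition gmax_le (x y : gmax G) : bool :=
  match x, y with
  | None, _ => true
  | Some _, None => false
  | Some a, Some b => (a <= b)%O
  end.

Fact gmax_le_refl : reflexive gmax_le. Proof. by case=> [a|] /=. Qed.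

Fact gmax_le_anti : antisymmetric gmax_le.
Proof. by case=> [a|] [b|] //= /le_anti ->. Qed.

Fact gmax_le_trans : transitive gmax_le.
Proof. by case=> [a|] [b|] [c|] //=; apply: le_trans. Qed.

HB.instance Definition _ := Order.Le_isPOrder.Build d (gmax G)
  gmax_le_refl gmax_le_anti gmax_le_trans.

Fact gmax_le_total : total (<=%O : rel (gmax G)).
Proof. by case=> [a|] [b|] //=; apply: le_total. Qed.

HB.instance Definition _ := Order.POrder_isTotal.Build d (gmax G)
  gmax_le_total.

Definition gmax_add (x y : gmax G) : set (gmax G) :=
  if x == y then [set z | (z <= x)%O] else [set Order.max x y].

Definition gmax_mul (x y : gmax G) : gmax G :=
  match x, y with Some a, Some b => Some (a * b)%g | _, _ => None end.

Definition gmax_inv (x : gmax G) : gmax G :=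
  if x is Some a then Some (a^-1)%g else None.

Let zero : gmax G := None.
Let one : gmax G := Some 1%g.

Lemma gmax_le0 (x : gmax G) : (zero <= x)%O. Proof. by []. Qed.

Lemma gmax_addC (x y : gmax G) : gmax_add x y = gmax_add y x.
Proof. by rewrite /gmax_add eq_sym maxC; case: eqP => [->|]. Qed.

(* z \in x [+] y iff the maximum of x, y, z is attained at least twice *)
Lemma gmax_addP (x y z : gmax G) : gmax_add x y z <->
  [|| (x == y) && (z <= x)%O, (x == z) && (y <= x)%O | (y == z) && (x <= y)%O].
Proof.
rewrite /gmax_add; case: (ltgtP x y) => [xy|yx|<-] /=.
- by rewrite !andbF /= andbT; split => [->|/eqP ->].
- by rewrite !andbF /= orbF andbT; split => [->|/eqP ->].
- split=> [->//|/or3P[//| |]]; by rewrite andbT => /eqP ->.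
Qed.

Lemma gmax_addA_sub (x y z : gmax G) :
  \bigcup_(t in gmax_add x y) gmax_add t z `<=`
  \bigcup_(t in gmax_add y z) gmax_add x t.
Proof.
move=> w [t /gmax_addP h1 /gmax_addP h2].
have pick s : [|| (y == z) && (s <= y)%O, (y == s) && (z <= y)%O
      | (z == s) && (y <= z)%O] ->
    [|| (x == s) && (w <= x)%O, (x == w) && (s <= x)%O
      | (s == w) && (x <= s)%O] ->
    (\bigcup_(t in gmax_add y z) gmax_add x t) w.
  by move=> p q; exists s; apply/gmax_addP.
case/or3P: h1 => /andP[/eqP ? a]; case/or3P: h2 => /andP[/eqP ? b]; subst.
all: try (have c := le_trans b a).
all: try (have c := le_trans a b).
all: try (pose proof I as c).
all: try solve [apply: (pick y); rewrite ?eqxx ?lexx ?a ?b ?c ?orbT //].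
all: try solve [apply: (pick z); rewrite ?eqxx ?lexx ?a ?b ?c ?orbT //].
all: try solve [apply: (pick w); rewrite ?eqxx ?lexx ?a ?b ?c ?orbT //].
all: try solve [apply: (pick x); rewrite ?eqxx ?lexx ?a ?b ?c ?orbT //].
all: try solve [apply: (pick zero); rewrite ?gmax_le0 ?eqxx ?lexx ?a ?b ?c ?orbT //].
- case: (leP y w) => [yw|/ltW wy].
    by apply: (pick w); rewrite !eqxx yw ?orbT.
  by apply: (pick y); rewrite !eqxx wy ?orbT.
- case: (leP y z) => [yz|/ltW zy].
    by apply: (pick z); rewrite !eqxx ?yz ?b ?orbT.
  by apply: (pick y); rewrite !eqxx ?zy ?a ?orbT.
- case: (leP x w) => [xw|/ltW wx].
    by apply: (pick w); rewrite !eqxx ?xw ?b ?orbT.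
  by apply: (pick x); rewrite !eqxx ?wx ?a.
Qed.

Lemma gmax_addA (x y z : gmax G) :
  \bigcup_(t in gmax_add x y) gmax_add t z =
  \bigcup_(t in gmax_add y z) gmax_add x t.
Proof.
apply/seteqP; split; first exact: gmax_addA_sub.
move=> w [t yzt xtw].
have [] := @gmax_addA_sub z y x w; last first.
  by move=> s syx szw; exists s; rewrite gmax_addC.
by exists t; rewrite gmax_addC.
Qed.

Lemma gmax_add0 (x : gmax G) : gmax_add x zero = [set x].
Proof.
apply/seteqP; split=> [z /gmax_addP|_ ->]; last first.
  by apply/gmax_addP; rewrite eqxx gmax_le0 orbT.
case/or3P => /andP[/eqP]; last by move=> <- x0; apply: le_anti; rewrite x0.
  by move=> -> z0; apply: le_anti; rewrite z0 gmax_le0.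
by move=> ->.
Qed.

Lemma gmax_add_neq0 (x y : gmax G) : gmax_add x y !=set0.
Proof.
exists (Order.max x y); rewrite /gmax_add.
by case: eqP => [->|//]; rewrite /= maxxx.
Qed.

Lemma gmax_oppP (x y : gmax G) : gmax_add x y zero <-> y = x.
Proof.
split=> [/gmax_addP/or3P[]/andP[/eqP]|->]; last by apply/gmax_addP; rewrite eqxx.
- by [].
- by move=> -> y0; apply: le_anti; rewrite y0 gmax_le0.
- by move=> -> x0; apply: le_anti; rewrite x0 gmax_le0.
Qed.

Lemma gmax_add_rev (x y z : gmax G) : gmax_add y z x -> gmax_add x y z.
Proof.
move/gmax_addP => h; apply/gmax_addP; case/or3P: h => /andP[/eqP -> ->].
- by rewrite eqxx ?orbT.
- by rewrite eqxx.
- by rewrite eqxx orbT.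
Qed.

Lemma gmax_mulA : associative gmax_mul.
Proof. by case=> [a|] [b|] [c|] //=; rewrite mulgA. Qed.

Lemma gmax_mul1l : left_id one gmax_mul.
Proof. by case=> [a|] //=; rewrite mul1g. Qed.

Lemma gmax_mul1r : right_id one gmax_mul.
Proof. by case=> [a|] //=; rewrite mulg1. Qed.

Lemma gmax_mul0l : left_zero zero gmax_mul. Proof. by case. Qed.

Lemma gmax_mul0r : right_zero zero gmax_mul. Proof. by case. Qed.

Lemma gmax_mulV (x : gmax G) : x != zero -> gmax_mul x (gmax_inv x) = one.
Proof. by case: x => [a|] //= _; rewrite mulgV. Qed.

Lemma gmax_mulVl (x : gmax G) : x != zero -> gmax_mul (gmax_inv x) x = one.
Proof. by case: x => [a|] //= _; rewrite mulVg. Qed.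

Lemma gmax_add_image (f g : gmax G -> gmax G) (x y : gmax G) :
    cancel f g -> cancel g f -> {homo f : x y / (x <= y)%O} ->
    {homo g : x y / (x <= y)%O} ->
  f @` gmax_add x y = gmax_add (f x) (f y).
Proof.
move=> fK gK fle gle.
have fm : {mono f : u v / (u <= v)%O}.
  by move=> u v; apply/idP/idP => [/gle|/fle //]; rewrite !fK.
have E z : gmax_add (f x) (f y) (f z) <-> gmax_add x y z.
  by rewrite !gmax_addP !fm !(can_eq fK).
apply/seteqP; split=> [_ [z h <-]|z h]; first exact/E.
by exists (g z); rewrite ?gK // -E gK.
Qed.

Lemma gmax_mulDl (a x y : gmax G) :
  gmax_mul a @` gmax_add x y = gmax_add (gmax_mul a x) (gmax_mul a y).
Proof.
case: a => [a|].
  apply: (@gmax_add_image _ (gmax_mul (Some a^-1)%g)).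
  - by case=> //= z; rewrite mulKg.
  - by case=> //= z; rewrite mulVKg.
  - by case=> [u|] [v|] //; apply: leg_mul2l.
  - by case=> [u|] [v|] //; apply: leg_mul2l.
rewrite !gmax_mul0l gmax_add0; have [w h] := gmax_add_neq0 x y.
apply/seteqP; split=> [_ [z _ <-]|_ ->]; first exact: gmax_mul0l.
by exists w; rewrite ?gmax_mul0l.
Qed.

Lemma gmax_mulDr (a x y : gmax G) :
  gmax_mul^~ a @` gmax_add x y = gmax_add (gmax_mul x a) (gmax_mul y a).
Proof.
case: a => [a|].
  apply: (@gmax_add_image (gmax_mul^~ (Some a)) (gmax_mul^~ (Some a^-1)%g)).
  - by case=> //= z; rewrite mulgK.
  - by case=> //= z; rewrite mulgVK.
  - by case=> [u|] [v|] //; apply: leg_mul2r.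
  - by case=> [u|] [v|] //; apply: leg_mul2r.
rewrite !gmax_mul0r gmax_add0; have [w h] := gmax_add_neq0 x y.
apply/seteqP; split=> [_ [z _ <-]|_ ->]; first exact: gmax_mul0r.
by exists w; rewrite ?gmax_mul0r.
Qed.

Definition Gmax : skewHyperfield :=
  @SkewHyperfield (gmax G) gmax_add zero id gmax_mul one gmax_inv
    gmax_add_neq0 gmax_addC gmax_addA gmax_add0 gmax_oppP gmax_add_rev
    gmax_mulA gmax_mul1l gmax_mul1r gmax_mul0l gmax_mul0r
    gmax_mulDl gmax_mulDr isT gmax_mulV gmax_mulVl.

End GmaxOrder.

Section SetSystems.
Variable E : finType.
Implicit Types (Cs : set {set E}) (A B C D I : {set E}).

Definition modular_pair Cs A B : Prop :=
  A != B /\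
  forall A' B', Cs A' -> Cs B' -> A' != B' -> ~~ (A' :|: B' \proper A :|: B).

(* For Cs the set of circuits of an (ordinary) matroid N on E: the independent
   sets and bases of N, the independent sets of the dual N^*, whose bases are the
   complements of the bases of N, and the circuits of N^*. *)
Definition indep Cs I : Prop := forall C, Cs C -> ~~ (C \subset I).

Definition basis Cs B : Prop :=
  indep Cs B /\ forall I, indep Cs I -> B \subset I -> I = B.

Definition dual_indep Cs I : Prop := exists2 B, basis Cs B & I \subset ~: B.

Definition dual_circuits Cs : set {set E} :=
  [set D | ~ dual_indep Cs D /\ forall A, A \proper D -> dual_indep Cs A].

End SetSystems.

Section Matroids.
Variables (H : skewHyperfield) (E : finType).
Local Notation vec := {ffun E -> H}.
Implicit Types (C D Q : set vec) (X Y Z : vec).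

Definition zerov : vec := [ffun=> hzero H].

Definition supp X : {set E} := [set e | X e != hzero H]%SET.

Definition lscale (a : H) X : vec := [ffun e => hmul a (X e)].
Definition rscale (a : H) X : vec := [ffun e => hmul (X e) a].

Definition haddv X Y : set vec := [set Z | forall e, hadd (X e) (Y e) (Z e)].

Definition matroid_axioms (scale : H -> vec -> vec) C : Prop :=
  [/\ ~ C zerov,
      forall X a, C X -> a != hzero H -> C (scale a X),
      forall X Y, C X -> C Y -> supp X \subset supp Y ->
        exists2 a, a != hzero H & Y = scale a X
    & forall X Y e, C X -> C Y ->
        modular_pair (supp @` C) (supp X) (supp Y) ->
        X e = hopp (Y e) -> X e != hzero H ->
        exists Z, [/\ C Z, Z e = hzero H & haddv X Y Z]].

(* A left (right) H-matroid on E is given by its set C of circuits. *)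
Definition left_matroid C : Prop := matroid_axioms lscale C.
Definition right_matroid C : Prop := matroid_axioms rscale C.

Fixpoint hsum (s : seq H) : set H :=
  if s is x :: s' then \bigcup_(y in hsum s') hadd x y else [set hzero H].

Definition orthogonal X Y : Prop :=
  hsum [seq hmul (X e) (Y e) | e <- enum E] (hzero H).

Definition orthogonal_upto (k : nat) C D : Prop :=
  forall X Y, C X -> D Y -> #|supp X :&: supp Y| <= k -> orthogonal X Y.

(* D is the set of circuits of the dual M^* of the left H-matroid M with set of
   circuits C: the right H-matroid whose underlying matroid is dual to that of
   M, and with C and D 3-orthogonal. *)
Definition is_dual C D : Prop :=
  [/\ right_matroid D, supp @` D = dual_circuits (supp @` C)
    & orthogonal_upto 3 C D].

Definition cocircuits C : set vec := [set Y | exists2 D, is_dual C D & D Y].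

Definition vectors C : set vec :=
  [set V | forall Y, cocircuits C Y -> orthogonal V Y].

End Matroids.

Section Minors.
Variables (H : skewHyperfield) (E : finType).
Implicit Types (Q : set {ffun E -> H}) (e : E).

(* the ground set E \ e *)
Definition del (e : E) : finType := {x : E | x != e}.

Definition restr e (X : {ffun E -> H}) : {ffun del e -> H} :=
  [ffun x : del e => X (val x)].

(* Q^e and Q_e *)
Definition proj Q e : set {ffun del e -> H} := restr e @` Q.
Definition slice Q e : set {ffun del e -> H} :=
  restr e @` [set X | Q X /\ X e = hzero H].

Arguments proj Q e : clear implicits.
Arguments slice Q e : clear implicits.

Definition support_minimal (F : finType) (Q : set {ffun F -> H}) :
    set {ffun F -> H} :=
  [set X | [/\ Q X, X <> zerov H F & forall Y, Q Y -> Y <> zerov H F ->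
                       ~~ (supp Y \proper supp X)]].

(* the sets of circuits of M \ e and M / e, for C the set of circuits of M *)
Definition deletion (C : set {ffun E -> H}) e := slice C e.
Definition contraction (C : set {ffun E -> H}) e := support_minimal (proj C e).

End Minors.

Arguments proj {H E} Q e _.
Arguments slice {H E} Q e _.
Arguments deletion {H E} C e _.
Arguments contraction {H E} C e _.

(* Main.v *)
(* Underlying matroids are handled through Minty's painting property, which is
   self-dual and passes to minors. Given a left matroid C on Gamma_max, every
   element of C restricted to E \ e is a pointwise maximum of circuits of C / e;
   this makes C / e a left matroid, and contracting down to a rank one matroid
   produces, on each cocircuit support, a vector orthogonal to all of C. Hence C
   has a dual D with full orthogonality, D is determined by C, and deletion and
   contraction of C correspond to contraction and deletion of D.

   A Farkas-type alternative shows that a vector V orthogonal to D is a pointwise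
   maximum of circuits: for each f with V_f <> 0 there is a circuit X <= V with
   X_f = V_f. Conversely such maxima are orthogonal to D, so vectors of a minor
   lift to vectors of C by lifting the circuits below them. *)

Require Import Defs.
From mathcomp Require Import all_boot all_order.
From mathcomp Require Import boolp classical_sets.

Set Implicit Arguments.
Unset Strict Implicit.
Unset Printing Implicit Defensive.

Import Order.TTheory.

Local Open Scope classical_set_scope.

(** [cocircuits C] collects the members of every [D] with [is_dual C D]. If no dual existed, every
    tuple would be a vector, so existence and uniqueness of the dual must be settled before vectors
    of minors can be compared. The obstacle is that the axioms allow elimination only for modular
    pairs: each use of it needs a prior proof of modularity, and that is a statement about supports.
    Hence supports are controlled first, and entries are then read off from circuits meeting a
    cocircuit in two elements, or the union of a modular pair of cocircuits in at most three. The
    order of [Gmax] enters through domination. Restricting a circuit to the complement of [e] may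
    destroy support-minimality, but the result is still a pointwise maximum of circuits of the
    contraction, and orthogonality to a fixed vector passes to such maxima. Circuits scale on the
    left and cocircuits on the right, so no step needs a commutative group. *)

(** * Crossing, painting and elimination for families of sets *)

Section SetSystems.
Variable F : finType.
Implicit Types (Cs Ds : set {set F}) (A B K R W : {set F}).

(** The matroid fact that a circuit and a cocircuit never share exactly one element; it is the trace
    of orthogonality on supports. *)
Definition crossing Cs Ds := forall A B x, Cs A -> Ds B -> x \in A -> x \in B ->
  exists y, [/\ y != x, y \in A & y \in B].

(* Minty's painting property. *)
Definition painting Cs Ds := forall x R,
  (exists A, [/\ Cs A, x \in A & forall y, y \in A -> y != x -> y \in R]) \/
  (exists B, [/\ Ds B, x \in B & forall y, y \in B -> y != x -> y \notin R]).

Definition antichain Cs := forall A B, Cs A -> Cs B -> A \subset B -> A = B.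

Definition min_sets Cs : set {set F} := [set A | [/\ Cs A, A != finset.set0 &
  forall B, Cs B -> B != finset.set0 -> ~~ (B \proper A)]].

(** For the circuits of a matroid these are the complements of flats, that is, the unions of
    cocircuits; [min_sets] then singles out the cocircuits. *)
Definition crossing_sets Cs : set {set F} :=
  [set B | forall A x, Cs A -> x \in A -> x \in B ->
     exists y, [/\ y != x, y \in A & y \in B]].

Lemma min_sets_antichain Cs : antichain (min_sets Cs).
Proof.
move=> A B [CA A0 _] [_ _ minB] AB; apply/eqP; rewrite eqEproper AB /=.
exact: minB.
Qed.

Lemma painting_sym Cs Ds : painting Cs Ds -> painting Ds Cs.
Proof.
move=> pt x R; have [[A [CA xA AR]]|[B [DB xB BR]]] := pt x (~: R)%SET; [right|left].
  by exists A; split=> // y yA yx; have := AR y yA yx; rewrite finset.in_setC.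
by exists B; split=> // y yB yx; have := BR y yB yx; rewrite finset.in_setC negbK.
Qed.

(* A largest R' is a hyperplane avoiding x, with x added to it. *)
Lemma max_unpainted Cs x R :
  ~ (exists A, [/\ Cs A, x \in A & forall y, y \in A -> y != x -> y \in R]) ->
  exists2 R' : {set F}, [/\ R \subset R', x \in R' & forall g, g \notin R' ->
      exists A, [/\ Cs A, x \in A, g \in A &
        forall y, y \in A -> y != x -> y != g -> y \in R']] &
    ~ (exists A, [/\ Cs A, x \in A & forall y, y \in A -> y != x -> y \in R']).
Proof.
pose Q (T : {set F}) :=
  exists A, [/\ Cs A, x \in A & forall y, y \in A -> y != x -> y \in T].
move=> nQ; have [|R' /maxsetP[/asboolP nQ' maxR'] RR'] :=
  @maxset_exists _ (fun T => `[< ~ Q T >]) R; first exact/asboolP.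
have grow g : g \notin R' -> Q (g |: R').
  move=> gR'; apply: contrapT => nQg; have /= := maxR' (g |: R') _ (finset.subsetUr _ _).
  by move/(_ (asboolT nQg)) => E; rewrite -E finset.setU11 in gR'.
exists R'; last exact: nQ'.
split=> // [|g gR'].
  apply: contrapT => /negP/grow[A [CA xA AR]]; apply: nQ'; exists A; split=> //.
  by move=> y yA yx; move: (AR y yA yx); rewrite finset.in_setU1 (negPf yx).
have [A [CA xA AR]] := grow g gR'; exists A; split=> //.
  apply: contrapT => /negP gA; apply: nQ'; exists A; split=> // y yA yx.
  move: (AR y yA yx); rewrite finset.in_setU1 => /predU1P[yg|//].
  by rewrite yg (negPf gA) in yA.
by move=> y yA yx yg; move: (AR y yA yx); rewrite finset.in_setU1 (negPf yg).
Qed.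

(** Once [R] is enlarged to a maximal [R'], any [B] that painting supplies is already minimal: some
    member of [Cs] through [x] and one element outside [R'], otherwise inside [R'], would meet a
    smaller nonempty [B'] in a single element. *)
Lemma painting_min Cs Ds :
  crossing Cs Ds -> painting Cs Ds -> painting Cs (min_sets Ds).
Proof.
move=> cr pt x R.
have [?|/max_unpainted[R' [RR' xR' grow] nQ]] :=
  EM (exists A, [/\ Cs A, x \in A & forall y, y \in A -> y != x -> y \in R]).
  by left.
right; have [//|[B [DB xB BR]]] := pt x R'.
exists B; split=> // [|y yB yx]; last first.
  by apply: contra (BR y yB yx); apply: (fintype.subsetP RR').
split=> // [|B' DB' B'0]; first by apply/finset.set0Pn; exists x.
apply/negP => /fintype.properP[/fintype.subsetP B'B [g gB gB']].
have [xB'|xB'] := boolP (x \in B').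
  have gx : g != x by apply: contraNneq gB' => ->.
  have [A [CA xA gA AR]] := grow g (BR g gB gx).
  have [y [yx yA yB']] := cr _ _ _ CA DB' xA xB'.
  have yg : y != g by apply: contraNneq gB' => <-.
  by have := BR y (B'B _ yB') yx; rewrite AR.
have /finset.set0Pn[h hB'] := B'0.
have nx y : y \in B' -> y != x by move=> yB'; apply: contraNneq xB' => <-.
have [A [CA xA hA AR]] := grow h (BR h (B'B _ hB') (nx _ hB')).
have [y [yh yA yB']] := cr _ _ _ CA DB' hA hB'.
by have := BR y (B'B _ yB') (nx _ yB'); rewrite AR // nx.
Qed.

(** Paint [x] with [R] made of [y] and everything outside [K]: a member of [Ds] in the other
    alternative would lie in [K] and miss [y], against the antichain. *)
Lemma pair_circuit Cs Ds K x y : crossing Cs Ds -> painting Cs Ds ->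
  antichain Ds -> Ds K -> x \in K -> y \in K -> x != y ->
  exists A, [/\ Cs A, x \in A, y \in A &
    forall z, z \in A -> z \in K -> z = x \/ z = y].
Proof.
move=> cr pt anti DK xK yK xy.
have [[A [CA xA AR]]|[B [DB xB BR]]] := pt x (y |: ~: K)%SET.
  have P z : z \in A -> z \in K -> z != x -> z = y.
    move=> zA zK zx; move: (AR z zA zx).
    by rewrite finset.in_setU1 finset.in_setC zK orbF => /eqP.
  exists A; split=> // [|z zA zK].
    have [z [zx zA zK]] := cr _ _ _ CA DK xA xK.
    by rewrite -(P z zA zK zx).
  by have [->|/(P z zA zK)->] := eqVneq z x; [left|right].
have nyB : y \notin B.
  by apply/negP => /BR; rewrite eq_sym finset.setU11 => /(_ xy).
suff BK : B = K by rewrite BK yK in nyB.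
apply: anti => //; apply/fintype.subsetP => z zB.
have [->//|/(BR z zB)] := eqVneq z x.
by rewrite finset.in_setU1 finset.in_setC negb_or negbK => /andP[].
Qed.

(** Links the definition of the dual through bases to crossing and painting. The substance is that a
    set containing no member of [Ds] is disjoint from some basis. *)
Lemma crossing_dual_circuits Cs Ds : crossing Cs Ds -> painting Cs Ds ->
  antichain Ds -> ~ Cs finset.set0 -> ~ Ds finset.set0 -> dual_circuits Cs = Ds.
Proof.
move=> cr pt anti C0 D0.
have circ_in A x I : indep Cs I -> Cs A -> A \subset x |: I -> x \in A.
  move=> iI CA AI; apply: contraT => xA; have := iI A CA.
  suff -> : A \subset I by [].
  apply/fintype.subsetP => y yA; have := fintype.subsetP AI y yA.
  by rewrite finset.in_setU1 => /predU1P[yx|//]; rewrite yx (negPf xA) in yA.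
have dep x B : indep Cs B -> ~ indep Cs (x |: B) ->
    exists A, [/\ Cs A, x \in A & forall y, y \in A -> y != x -> y \in B].
  move=> iB nI; apply: contrapT => nA; apply: nI => A CA; apply/negP => sA.
  apply: nA; exists A; split=> // [|y yA yx]; first exact: circ_in iB CA sA.
  by have := fintype.subsetP sA y yA; rewrite finset.in_setU1 (negPf yx).
have basis_dep x B : basis Cs B -> x \notin B ->
    exists A, [/\ Cs A, x \in A & forall y, y \in A -> y != x -> y \in B].
  move=> [iB mB] xB; apply: dep => // iBx.
  by rewrite -(mB _ iBx (finset.subsetUr _ _)) finset.setU11 in xB.
have dindepP I : dual_indep Cs I <-> forall B, Ds B -> ~~ (B \subset I).
  split=> [[B bB IB] K DK|nK].
    apply/negP => KI; have KB : forall y, y \in K -> y \notin B.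
      move=> y yK; have := fintype.subsetP IB y (fintype.subsetP KI y yK).
      by rewrite finset.in_setC.
    have [K0|/finset.set0Pn[x xK]] := eqVneq K finset.set0; first by rewrite K0 in DK.
    have [A [CA xA AB]] := basis_dep x B bB (KB x xK).
    have [y [yx yA yK]] := cr _ _ _ CA DK xA xK.
    by have := KB y yK; rewrite AB.
  have ind0 : indep Cs finset.set0.
    move=> A CA; rewrite finset.subset0; apply/eqP => A0; by rewrite A0 in CA.
  (* A maximal independent set [B] off [I] is a basis: if some [x] could be added, painting would
     give [K] disjoint from [B], with an element [g] outside [I], and the circuit closing [g] over
     [B] would meet [K] only in [g]. *)
  have [B /maxsetP[/andP[/asboolP iB BI] mB] _] :=
    @maxset_exists _ (fun T : {set F} => `[< indep Cs T >] && (T \subset ~: I)%SET)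
      finset.set0 (introT andP (conj (asboolT ind0) (finset.sub0set _))).
  exists B; last by rewrite finset.subsetC.
  split=> // I' iI' BI'; apply/eqP; rewrite eq_sym finset.eqEsubset BI' /=.
  apply/fintype.subsetP => x xI'; apply: contraT => xB.
  have iBx : indep Cs (x |: B).
    move=> A CA; apply: contra (iI' A CA) => /fintype.subset_trans; apply.
    by rewrite finset.subUset finset.sub1set xI'.
  have [[A [CA xA AB]]|[K [DK xK KB]]] := pt x B.
    have := iBx A CA; suff -> : A \subset x |: B by [].
    apply/fintype.subsetP => y yA; rewrite finset.in_setU1.
    by have [//|yx] := eqVneq y x; rewrite AB.
  have /fintype.subsetPn[g gK gI] := nK K DK.
  have gB : g \notin B.
    have [->//|gx] := eqVneq g x; exact: KB.
  have [|A [CA gA AB]] := @dep g B iB.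
    move=> iBg; have := mB (g |: B) _ (finset.subsetUr _ _).
    rewrite (asboolT iBg) finset.subUset BI finset.sub1set finset.in_setC gI => /(_ isT) E.
    by rewrite -E finset.setU11 in gB.
  have [y [yg yA yK]] := cr _ _ _ CA DK gA gK.
  have yB := AB y yA yg; have [yx|/(KB y yK)] := eqVneq y x; last by rewrite yB.
  by rewrite -yx yB in xB.
apply/seteqP; split=> K.
  move=> [nK mK]; move: nK; rewrite dindepP => /existsNP[B] /not_implyP[DB].
  move/negP; rewrite negbK => BK; move: BK; rewrite subEproper => /predU1P[<-//|/mK].
  by rewrite dindepP => /(_ B DB); rewrite fintype.subxx.
move=> DK; split=> [|A AK].
  by rewrite dindepP => /(_ K DK); rewrite fintype.subxx.
rewrite dindepP => B DB; apply/negP => BA.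
have := anti _ _ DB DK (fintype.subset_trans BA (proper_sub AK)) => E.
by rewrite E in BA; move: AK; rewrite fintype.properE BA andbF.
Qed.

Definition weak_elimination Cs := forall A B x, Cs A -> Cs B -> A != B ->
  x \in A -> x \in B ->
  exists W, [/\ Cs W, x \notin W & W \subset A :|: B].

Definition strong_elimination Cs := forall A B x z, Cs A -> Cs B ->
  x \in A -> x \in B -> z \in A -> z \notin B ->
  exists W, [/\ Cs W, x \notin W, z \in W & W \subset A :|: B].

(* In a minimal non-modular counterexample, a pair with smaller union would still
   have x in both members. *)
Lemma modular_weak_elimination Cs :
  (forall A B x, Cs A -> Cs B -> modular_pair Cs A B -> x \in A -> x \in B ->
     exists W, [/\ Cs W, x \notin W & W \subset A :|: B]) ->
  weak_elimination Cs.
Proof.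
move=> me A B x; have [n] := ubnP #|A :|: B|.
elim: n A B => // n IH A B lt CA CB AB xA xB.
have [mod|] := EM (modular_pair Cs A B); first exact: me.
move=> /not_andP[//|/existsNP[A' /existsNP[B']]].
move=> /not_implyP[CA'] /not_implyP[CB'] /not_implyP[AB'].
move/negP; rewrite negbK => pr; have sub := proper_sub pr.
have [xA'|xA'] := boolP (x \in A'); last first.
  by exists A'; split=> //; apply: fintype.subset_trans sub; apply: finset.subsetUl.
have [xB'|xB'] := boolP (x \in B'); last first.
  by exists B'; split=> //; apply: fintype.subset_trans sub; apply: finset.subsetUr.
have [|W [CW xW WU]] := IH A' B' _ CA' CB' AB' xA' xB'.
  by apply: leq_trans (proper_card pr) _; rewrite -ltnS.
by exists W; split=> //; apply: fintype.subset_trans sub.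
Qed.

(** If weak elimination yields [W] missing [z], take [g] in [W] outside [A]. Eliminating [g] from
    [B] and [W] while keeping [x] gives [V]; eliminating [x] from [A] and [V] then keeps [z]. The
    first union misses [z] and the second misses [g], so the induction applies to both. *)
Lemma weak_strong_elimination Cs :
  antichain Cs -> weak_elimination Cs -> strong_elimination Cs.
Proof.
move=> anti we A B x z; have [n] := ubnP #|A :|: B|.
elim: n A B x z => // n IH A B x z lt CA CB xA xB zA zB.
have AB : A != B by apply: contraNneq zB => <-.
have [W [CW xW WU]] := we _ _ _ CA CB AB xA xB.
have [zW|zW] := boolP (z \in W); first by exists W.
have /fintype.subsetPn[g gW gA] : ~~ (W \subset A).
  by apply/negP => /(anti _ _ CW CA) E; rewrite E xA in xW.
have gB : g \in B by have := fintype.subsetP WU g gW; rewrite finset.in_setU (negPf gA).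
have BWU : B :|: W \subset A :|: B by rewrite finset.subUset WU finset.subsetUr.
have [|V [CV gV xV VU]] := IH B W g x _ CB CW gB gW xB xW.
  apply: leq_trans (_ : #|B :|: W| < #|A :|: B|) _; last by rewrite -ltnS.
  apply: proper_card; apply/fintype.properP; split=> //.
  by exists z; rewrite !finset.in_setU ?zA // negb_or zB.
have zV : z \notin V.
  by apply/negP => /(fintype.subsetP VU); rewrite finset.in_setU (negPf zB) (negPf zW).
have AVU : A :|: V \subset A :|: B.
  by rewrite finset.subUset finset.subsetUl /=; apply: fintype.subset_trans BWU.
have [|T [CT xT zT TU]] := IH A V x z _ CA CV xA xV zA zV.
  apply: leq_trans (_ : #|A :|: V| < #|A :|: B|) _; last by rewrite -ltnS.
  apply: proper_card; apply/fintype.properP; split=> //.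
  by exists g; rewrite !finset.in_setU ?gB ?orbT // negb_or gA.
by exists T; split=> //; apply: fintype.subset_trans AVU.
Qed.

(** With [R'] maximal, [x] and the complement of [R'] form a crossing set. If [A] met it only in
    some [z] other than [x], eliminating [z] from [A] and a member through [x] and [z] would leave a
    member through [x] lying otherwise in [R']. *)
Lemma elimination_painting Cs :
  strong_elimination Cs -> painting Cs (min_sets (crossing_sets Cs)).
Proof.
move=> se; apply: painting_min => [A B x CA DB xA xB|x R].
  exact: (DB A x).
have [?|/max_unpainted[R' [RR' xR' grow] nQ]] :=
  EM (exists A, [/\ Cs A, x \in A & forall y, y \in A -> y != x -> y \in R]).
  by left.
right; exists (x |: ~: R')%SET; split; first last.
- move=> y; rewrite finset.in_setU1 finset.in_setC => /orP[->//|yR' _].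
  by apply: contra yR'; apply: (fintype.subsetP RR').
- exact: finset.setU11.
move=> A z CA zA zU; apply: contrapT => no.
have AR y : y \in A -> y != z -> y != x /\ y \in R'.
  move=> yA yz; apply/andP; apply: contraT.
  rewrite negb_and negbK => yU; case: no; exists y; split=> //.
  by rewrite finset.in_setU1 finset.in_setC.
have [zx|zx] := eqVneq z x.
  apply: nQ; exists A; split=> //; first by rewrite -zx.
  by move=> y yA; rewrite -zx => /(AR y yA)[].
have zR' : z \notin R' by move: zU; rewrite finset.in_setU1 (negPf zx) finset.in_setC.
have [Z [CZ xZ zZ ZR]] := grow z zR'.
have xA : x \notin A by apply/negP => /AR; rewrite eq_sym eqxx => /(_ zx)[].
have [W [CW zW xW WU]] := se Z A z x CZ CA zZ zA xZ xA.
apply: nQ; exists W; split=> // y yW yx.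
have yz : y != z by apply: contraNneq zW => <-.
have := fintype.subsetP WU y yW; rewrite finset.in_setU => /orP[yZ|yA]; first exact: ZR.
by have [] := AR y yA yz.
Qed.

End SetSystems.

(** * Hyperaddition and orthogonality over [Gmax] *)

Section Tropical.
Variables (d : Order.disp_t) (Gamma : orderedGroupType d).
Local Notation H := (Gmax Gamma).
Local Notation "0" := (hzero H).
Local Notation "x ** y" := (@hmul H x y) (at level 40, left associativity).
Implicit Types (x y z w : H) (s : seq H).

Lemma haddP x y z : hadd x y z <->
  [|| (x == y) && (z <= x)%O, (x == z) && (y <= x)%O | (y == z) && (x <= y)%O].
Proof. exact: gmax_addP. Qed.

Lemma le0h x : (0 <= x)%O. Proof. by []. Qed.

Lemma leh0 x : (x <= 0)%O = (x == 0).
Proof. by apply/idP/eqP => [x0|->//]; apply: le_anti; rewrite x0 le0h. Qed.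

Lemma lt0h x : (0 < x)%O = (x != 0).
Proof. by rewrite lt_neqAle le0h andbT eq_sym. Qed.

Lemma hmul_eq0 x y : (x ** y == 0) = (x == 0) || (y == 0).
Proof. by case: x y => [a|] [b|]. Qed.

Lemma hmul_neq0 x y : (x ** y != 0) = (x != 0) && (y != 0).
Proof. by rewrite hmul_eq0 negb_or. Qed.

Lemma hinv_neq0 x : x != 0 -> hinv x != 0.
Proof. by case: x. Qed.

Lemma hle_mul2l z x y : (x <= y)%O -> (z ** x <= z ** y)%O.
Proof. by case: z x y => [a|] [b|] [c|] //; apply: leg_mul2l. Qed.

Lemma hle_mul2r z x y : (x <= y)%O -> (x ** z <= y ** z)%O.
Proof. by case: z x y => [a|] [b|] [c|] //; apply: leg_mul2r. Qed.

Lemma hle_pmul2l z x y : z != 0 -> (z ** x <= z ** y)%O = (x <= y)%O.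
Proof.
move=> z0; apply/idP/idP => [/(hle_mul2l (hinv z))|/hle_mul2l//].
by rewrite !hmulA hmulVl // !hmul1l.
Qed.

Lemma hle_pmul2r z x y : z != 0 -> (x ** z <= y ** z)%O = (x <= y)%O.
Proof.
move=> z0; apply/idP/idP => [/(hle_mul2r (hinv z))|/hle_mul2r//].
by rewrite -!hmulA hmulV // !hmul1r.
Qed.

Lemma hlt_pmul2r z x y : z != 0 -> (x ** z < y ** z)%O = (x < y)%O.
Proof. by move=> z0; rewrite !ltNge hle_pmul2r. Qed.

Lemma hmul_injl z x y : z != 0 -> z ** x = z ** y -> x = y.
Proof.
move=> z0 E; apply: le_anti.
by rewrite -(hle_pmul2l x y z0) -(hle_pmul2l y x z0) E lexx.
Qed.

Lemma hmul_injr z x y : z != 0 -> x ** z = y ** z -> x = y.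
Proof.
move=> z0 E; apply: le_anti.
by rewrite -(hle_pmul2r x y z0) -(hle_pmul2r y x z0) E lexx.
Qed.

Lemma hadd_pmul2l z x1 x2 x3 : z != 0 ->
  hadd (z ** x1) (z ** x2) (z ** x3) <-> hadd x1 x2 x3.
Proof.
move=> z0; have E x y : (z ** x == z ** y) = (x == y).
  by apply/eqP/eqP => [/hmul_injl->|->].
by rewrite !haddP !E !hle_pmul2l.
Qed.

Lemma seq_maxP s : exists m, (forall y, y \in s -> (y <= m)%O) /\ (m = 0 \/ m \in s).
Proof.
elim: s => [|x s [m [mb mi]]]; first by exists 0; split; [|left].
case: (leP x m) => [xm|/ltW mx].
  exists m; split=> [y|]; first by rewrite inE => /predU1P[->//|/mb].
  by case: mi => [|mi]; [left|right; rewrite inE mi orbT].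
exists x; split=> [y|]; last by right; rewrite mem_head.
by rewrite inE => /predU1P[->//|/mb ym]; apply: le_trans mx.
Qed.

(** An upper bound that is not attained has count 0 and passes, so only the maximum is tested; lists
    of zeros are accepted whatever their length. *)
Definition max_twice s :=
  forall w, w != 0 -> (forall y, y \in s -> (y <= w)%O) -> count_mem w s != 1.

(** Every element is its own hyperinverse, so membership of [z] in the sum is the vanishing
    condition for the list with [z] added. *)
Lemma hsumP s z : hsum s z <-> max_twice (z :: s).
Proof.
elim: s z => [|x s IH] z.
  split=> [-> w w0 _|tw] /=; first by rewrite addn0 eqb1 eq_sym.
  apply/eqP; apply: contraT => z0; have := tw z z0; rewrite /= eqxx; apply => y.
  by rewrite inE => /eqP->.
split=> [[y /IH tw /haddP xyz] w w0 wmax|tw].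
  have xw : (x <= w)%O by apply: wmax; rewrite !inE eqxx orbT.
  have zw : (z <= w)%O by apply: wmax; rewrite inE eqxx.
  have sw u : u \in s -> (u <= w)%O by move=> us; apply: wmax; rewrite !inE us !orbT.
  have yw : (y <= w)%O.
    by case/or3P: xyz => /andP[/eqP E le]; subst => //; apply: le_trans le _.
  have /= cnt : count_mem w (y :: s) != 1.
    by apply: tw => // u; rewrite inE => /predU1P[->|/sw].
  case/or3P: xyz => /andP[/eqP E le] /=; rewrite -?E; rewrite -?E in cnt.
  - case: (eqVneq x w) cnt => [_|xw'] cnt.
      by case: (z == w); case: (count _ s) cnt.
    suff -> : z == w = false by [].
    by apply: contraNF xw' => /eqP zw'; rewrite eq_le xw -zw'.
  - case: (eqVneq x w) => [_|xw'] //=; move: cnt.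
    suff -> : y == w = false by [].
    by apply: contraNF xw' => /eqP yw'; rewrite eq_le xw -yw'.
  - case: (eqVneq y w) cnt => [_|yw'] cnt.
      by case: (x == w); case: (count _ s) cnt.
    suff -> : x == w = false by [].
    by apply: contraNF yw' => /eqP xw'; rewrite eq_le yw -xw'.
(* The partial sum over [s] has to be chosen: the larger of [x] and [z] if they differ; if they
   agree, the maximum [m] of [s], replaced by [x] when [m] exceeds [x]. *)
have [xz|zx|xz] := ltgtP x z.
- exists z; last by apply/haddP; rewrite eqxx (ltW xz) !orbT.
  apply/IH => w w0 wmax; have zw : (z <= w)%O by apply: wmax; rewrite inE eqxx.
  have xw := lt_le_trans xz zw; have := tw w w0; rewrite /= (lt_eqF xw) /=; apply.
  move=> y; rewrite !inE => /or3P[/eqP->//|/eqP->|ys]; first exact: ltW.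
  by apply: wmax; rewrite inE ys orbT.
- exists x; last by apply/haddP; rewrite eqxx (ltW zx) ?orbT.
  apply/IH => w w0 wmax; have xw : (x <= w)%O by apply: wmax; rewrite inE eqxx.
  have zw := lt_le_trans zx xw; have := tw w w0; rewrite /= (lt_eqF zw) /=; apply.
  move=> y; rewrite !inE => /or3P[/eqP->|/eqP->//|ys]; first exact: ltW.
  by apply: wmax; rewrite inE ys orbT.
have [m [mb mi]] := seq_maxP s; subst z.
have [mx|xm] := leP m x.
  exists m; last by apply/haddP; rewrite eqxx mx orbT.
  apply/IH => w w0 wmax /=; have mw : (m <= w)%O by apply: wmax; rewrite inE eqxx.
  have [E|ne] := eqVneq m w.
    subst w; case: mi => [E|]; first by rewrite E eqxx in w0.
    by rewrite -has_pred1 has_count; case: (count _ s).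
  rewrite add0n (_ : count_mem w s = 0)%N //; apply/eqP.
  rewrite -leqn0 leqNgt -has_count has_pred1; apply: contraNN ne => /mb wm.
  by rewrite eq_le mw.
exists x; last by apply/haddP; rewrite !eqxx lexx.
apply/IH => w w0 wmax; have xw : (x <= w)%O by apply: wmax; rewrite inE eqxx.
have mw : (m <= w)%O.
  by case: mi => [->//|ms]; apply: wmax; rewrite inE ms orbT.
have xw' := lt_le_trans xm mw; have := tw w w0; rewrite /= (lt_eqF xw') /=; apply.
by move=> y; rewrite !inE orbA orbb => ?; apply: wmax; rewrite inE.
Qed.

Section Orthogonal.
Variable E : finType.
Implicit Types (X Y Z V : {ffun E -> H}) (e f g : E).

(** A nonzero term dominated by no other term would be a maximum attained only once. *)
Lemma orthogonalP X Y : orthogonal X Y <-> forall f, X f ** Y f != 0 ->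
  exists2 g, g != f & (X f ** Y f <= X g ** Y g)%O.
Proof.
rewrite /orthogonal hsumP; pose P e := X e ** Y e; rewrite -/P.
have c0 w s : w != 0 -> count_mem w (0 :: s) = count_mem w s.
  by case: w.
have mE e : P e \in map P (enum E) by apply: map_f; rewrite mem_enum.
split=> [tw f Pf|orth w w0 wmax]; first have {}Pf : P f != 0 by [].
  apply: contrapT => no.
  have lt g : g != f -> (P g < P f)%O.
    by move=> gf; rewrite ltNge; apply/negP => le; apply: no; exists g.
  have := tw (P f) Pf; rewrite c0 // count_map.
  have -> : count (preim P (pred1 (P f))) (enum E) = count_mem f (enum E).
    apply: eq_count => g /=; have [->|/lt/lt_eqF//] := eqVneq g f; exact: eqxx.
  rewrite count_uniq_mem ?enum_uniq // mem_enum => /(_ _)/negP[]//.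
  move=> y; rewrite inE => /predU1P[->//|/mapP[g _ ->]].
  by have [->//|/lt/ltW] := eqVneq g f.
rewrite c0 // count_map; apply/negP => /eqP c1.
have : has (preim P (pred1 w)) (enum E) by rewrite has_count c1.
move=> /hasP[f _ /eqP Pf]; have [|g gf le] := orth f; first by rewrite -/(P f) Pf.
have Pg : P g = w.
  apply: le_anti; rewrite wmax ?inE ?mE ?orbT //=; move: le; by rewrite -/(P f) Pf.
have : (size [:: f; g] <= size [seq h <- enum E | preim P (pred1 w) h])%N.
  apply: uniq_leq_size; first by rewrite /= inE eq_sym gf.
  by move=> h; rewrite !inE mem_filter mem_enum /= => /pred2P[]->; rewrite ?Pf ?Pg eqxx.
by rewrite size_filter c1.
Qed.

Lemma in_supp X e : (e \in supp X) = (X e != 0).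
Proof. by rewrite inE. Qed.

Lemma orthogonal_crossing X Y (x : E) : orthogonal X Y -> x \in supp X ->
  x \in supp Y -> exists y : E, [/\ y != x, y \in supp X & y \in supp Y].
Proof.
rewrite !in_supp => /orthogonalP orth Xx Yx.
have [|y yx le] := orth x; first by rewrite hmul_neq0 Xx.
exists y; rewrite yx !in_supp; apply/and3P; rewrite -hmul_neq0 -lt0h.
by apply: lt_le_trans le; rewrite lt0h hmul_neq0 Xx.
Qed.

Lemma orthogonal_pair X Y (x y : E) : orthogonal X Y ->
  (forall z : E, z \in supp X -> z \in supp Y -> z = x \/ z = y) ->
  X x ** Y x = X y ** Y y.
Proof.
move=> /orthogonalP orth sub.
suff le u v : (forall z : E, z \in supp X -> z \in supp Y -> z = u \/ z = v) ->
    (X u ** Y u <= X v ** Y v)%O.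
  by apply: le_anti; rewrite !le // => z zX zY; have [] := sub z zX zY; auto.
move=> {}sub; have [->//|nz] := eqVneq (X u ** Y u) 0.
have [z zu le] := orth u nz.
have : X z ** Y z != 0 by rewrite -lt0h (lt_le_trans _ le) // lt0h.
rewrite hmul_neq0 => /andP[zX zY].
have [||zu0|<-//] := sub z; rewrite ?in_supp ?zX ?zY //.
by rewrite zu0 eqxx in zu.
Qed.

Lemma orthogonal_rscale a X Y : orthogonal X Y -> orthogonal X (rscale a Y).
Proof.
move=> /orthogonalP orth; apply/orthogonalP => f; rewrite !ffunE hmulA hmul_neq0.
move=> /andP[/orth[g gf le] a0]; exists g => //; rewrite ffunE hmulA.
exact: hle_mul2r.
Qed.

Lemma supp_rscale a X : a != 0 -> supp (rscale a X) = supp X.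
Proof. by move=> a0; apply/setP => e; rewrite !in_supp ffunE hmul_neq0 a0 andbT. Qed.

Lemma supp_lscale a X : a != 0 -> supp (lscale a X) = supp X.
Proof. by move=> a0; apply/setP => e; rewrite !in_supp ffunE hmul_neq0 a0. Qed.

Lemma supp_eq0 X : (supp X == finset.set0) = (X == zerov H E).
Proof.
apply/eqP/eqP => [E0|->].
  apply/ffunP => e; rewrite ffunE; apply/eqP; apply: contraT => Xe.
  by have := finset.in_set0 e; rewrite -E0 in_supp Xe.
by apply/setP => e; rewrite in_supp finset.in_set0 ffunE eqxx.
Qed.

Lemma supp_sub X Y : (forall e, X e != 0 -> Y e != 0) -> supp X \subset supp Y.
Proof. by move=> h; apply/fintype.subsetP => e; rewrite !in_supp; apply: h. Qed.

Lemma haddv_supp X Y Z : haddv X Y Z -> supp Z \subset supp X :|: supp Y.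
Proof.
move=> XYZ; apply/fintype.subsetP => e; rewrite finset.in_setU !in_supp -negb_and.
apply: contra => /andP[/eqP Xe /eqP Ye]; have := XYZ e; rewrite Xe Ye hadd0.
by move=> ->.
Qed.

End Orthogonal.
End Tropical.

(** * Dual pairs: the right matroid, uniqueness of the dual, vectors as maxima of circuits *)

Section DualPairs.
Variables (d : Order.disp_t) (Gamma : orderedGroupType d) (E : finType).
Local Notation H := (Gmax Gamma).
Local Notation "0" := (hzero H).
Local Notation "x ** y" := (@hmul H x y) (at level 40, left associativity).
Local Notation vec := {ffun E -> H}.
Implicit Types (C D : set vec) (X Y Z V : vec) (e f g h k x y z : E) (a b c : H).

Lemma hadd_max3 a b c : (a <= b)%O || (a <= c)%O -> (b <= a)%O || (b <= c)%O ->
  (c <= a)%O || (c <= b)%O -> hadd a b c.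
Proof.
move=> h1 h2 h3; have [ab|ba|ab] := ltgtP a b; apply/haddP.
- rewrite [X in X || _]leNgt ab /= in h2; have <- : b = c.
    by apply: le_anti; rewrite h2; case/orP: h3 => // /le_trans-> //; apply: ltW.
  by rewrite eqxx (ltW ab) !orbT.
- rewrite [X in X || _]leNgt ba /= in h1; have <- : a = c.
    by apply: le_anti; rewrite h1; case/orP: h3 => // /le_trans-> //; apply: ltW.
  by rewrite eqxx (ltW ba) !orbT.
by rewrite -ab orbb in h3; rewrite ab eqxx -ab h3.
Qed.

Lemma orthogonal_triple X Y g k h : orthogonal X Y ->
  (forall z, z \in supp X -> z \in supp Y -> [\/ z = g, z = k | z = h]) ->
  hadd (X g ** Y g) (X k ** Y k) (X h ** Y h).
Proof.
move=> /orthogonalP orth sub.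
suff le u v w : (forall z, z \in supp X -> z \in supp Y -> [\/ z = u, z = v | z = w]) ->
    (X u ** Y u <= X v ** Y v)%O || (X u ** Y u <= X w ** Y w)%O.
  by apply: hadd_max3; apply: le => z zX zY; case: (sub z zX zY) => ->;
    [constructor 1|constructor 2|constructor 3|constructor 2|constructor 1
    |constructor 3|constructor 2|constructor 3|constructor 1].
move=> {}sub; have [->|nz] := eqVneq (X u ** Y u) 0; first by rewrite !le0h.
have [z zu le] := orth u nz.
have : X z ** Y z != 0 by rewrite -lt0h (lt_le_trans _ le) // lt0h.
rewrite hmul_neq0 -!in_supp => /andP[zX zY].
case: (sub z zX zY) => ?; subst z; rewrite ?le ?orbT //.
by rewrite eqxx in zu.
Qed.

(** The fields are chosen to pass to minors, with painting in place of elimination; the matroid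
    axioms for [D] and its relation to [dual_circuits] are recovered from them. *)
Record dual_pair C D : Prop := DualPair {
  dp_circ0 : ~ C (zerov H E);
  dp_cocirc0 : ~ D (zerov H E);
  dp_lscale : forall X a, C X -> a != 0 -> C (lscale a X);
  dp_rscale : forall Y a, D Y -> a != 0 -> D (rscale a Y);
  dp_antichain : antichain (@supp H E @` D);
  dp_painting : painting (@supp H E @` C) (@supp H E @` D);
  dp_orthogonal : forall X Y, C X -> D Y -> orthogonal X Y
}.

Lemma supp_image0 C : ~ C (zerov H E) -> ~ (@supp H E @` C) finset.set0.
Proof. by move=> C0 [X CX /eqP]; rewrite supp_eq0 => /eqP E0; rewrite E0 in CX. Qed.

Section DualPairTheory.
Variables (C D : set vec) (CD : dual_pair C D).

Lemma dp_crossing : crossing (@supp H E @` C) (@supp H E @` D).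
Proof.
move=> _ _ x [X CX <-] [Y DY <-]; apply: orthogonal_crossing.
exact: dp_orthogonal CD _ _ CX DY.
Qed.

Lemma dp_paintingP x (R : {set E}) :
  (exists X, [/\ C X, X x != 0 & forall y, X y != 0 -> y != x -> y \in R]) \/
  (exists Y, [/\ D Y, Y x != 0 & forall y, Y y != 0 -> y != x -> y \notin R]).
Proof.
have [[_ [[X CX <-] Xx XR]]|[_ [[Y DY <-] Yx YR]]] := dp_painting CD x R; [left|right].
  by exists X; rewrite -in_supp; split=> // y; rewrite -in_supp; apply: XR.
by exists Y; rewrite -in_supp; split=> // y; rewrite -in_supp; apply: YR.
Qed.

Lemma dp_dual_circuits : dual_circuits (@supp H E @` C) = @supp H E @` D.
Proof.
apply: crossing_dual_circuits; [exact: dp_crossing|exact: dp_painting CD| | |].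
- exact: dp_antichain CD.
- exact: supp_image0 (dp_circ0 CD).
- exact: supp_image0 (dp_cocirc0 CD).
Qed.

(** A circuit meeting the support exactly in [x] and [y] forces the same ratio of these two entries
    in [Y] and in [Z]. The intersection has two elements, so 3-orthogonality is enough. *)
Lemma dp_proportional Y Z : D Y -> supp Z = supp Y ->
    (forall X, C X -> #|supp X :&: supp Z| <= 3 -> orthogonal X Z) ->
  exists2 a, a != 0 & Z = rscale a Y.
Proof.
move=> DY sZ orthZ.
have [Y0|/set0Pn[x]] := eqVneq (supp Y) finset.set0.
  by case: (dp_cocirc0 CD); move/eqP: Y0; rewrite supp_eq0 => /eqP <-.
rewrite in_supp => Yx; have Zx : Z x != 0 by rewrite -in_supp sZ in_supp.
exists (hinv (Y x) ** Z x); first by rewrite hmul_neq0 hinv_neq0.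
apply/ffunP => y; rewrite ffunE hmulA.
have [->|yx] := eqVneq y x; first by rewrite hmulV // hmul1l.
have [Yy|Yy] := eqVneq (Y y) 0.
  rewrite Yy !hmul0l; apply/eqP; apply: contraTT isT.
  by rewrite -in_supp sZ in_supp Yy eqxx.
have [||||_ [[X CX <-] Xx Xy XR]] :=
    @pair_circuit _ _ _ (supp Y) x y dp_crossing (dp_painting CD) (dp_antichain CD).
- by exists Y.
- by rewrite in_supp.
- by rewrite in_supp.
- by rewrite eq_sym.
have oY := orthogonal_pair (dp_orthogonal CD CX DY) XR.
have oZ : X x ** Z x = X y ** Z y.
  apply: orthogonal_pair => [|z]; last by rewrite sZ; apply: XR.
  apply: orthZ => //; apply: leq_trans (_ : #|[set x; y]%SET| <= _)%N.
    apply: subset_leq_card; apply/fintype.subsetP => z; rewrite sZ finset.in_setI.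
    case/andP => zX zY; rewrite finset.in_set2.
    by have [->|->] := XR z zX zY; rewrite eqxx ?orbT.
  by rewrite cards2; case: (x != y).
move: Xx Xy; rewrite !in_supp => Xx Xy; apply: (hmul_injl Xy).
rewrite -oZ !hmulA -oY -!hmulA; congr (_ ** _).
by rewrite hmulA hmulV // hmul1l.
Qed.

(** For elimination, let [U] be the union of a modular pair. The cocircuits inside [U] are those of
    a contraction of rank two, so there are circuits meeting [U] in at most three prescribed
    elements, and orthogonality to these yields every entry of the eliminating [Z]. *)
Lemma dp_right_matroid : right_matroid D.
Proof.
split; [exact: dp_cocirc0 CD|by move=> Y a; apply: dp_rscale CD _ _| |].
  move=> Y Z DY DZ sYZ; apply: dp_proportional => //; last first.
    by move=> X CX _; apply: dp_orthogonal CD _ _ CX DZ.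
  by apply/esym; apply: dp_antichain CD _ _ _ _ sYZ; [exists Y|exists Z].
move=> Y1 Y2 f D1 D2 [ne12 mod12] /= Y1f Yf.
pose U := supp Y1 :|: supp Y2.
have inU z : (z \in U) = (Y1 z != 0) || (Y2 z != 0) by rewrite finset.in_setU !in_supp.
(* Modularity in usable form: cocircuits inside [U] that are told apart by [w] have no common zero
   in [U]. *)
have mod Y Z w z : D Y -> D Z -> supp Y \subset U -> supp Z \subset U ->
    Y w = 0 -> Z w != 0 -> z \in U -> Y z = 0 -> Z z != 0.
  move=> DY DZ YU ZU Yw Zw zU Yz; apply/negP => /eqP Zz.
  have := mod12 (supp Y) (supp Z); case/(_ _ _ _)/negP.
  - by exists Y.
  - by exists Z.
  - by apply: contraNneq Zw => E0; rewrite -[_ == _]negbK -in_supp -E0 in_supp Yw eqxx.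
  apply/fintype.properP; split; first by rewrite finset.subUset YU.
  by exists z; rewrite // finset.in_setU !in_supp Yz Zz eqxx.
have sU1 : supp Y1 \subset U by apply: finset.subsetUl.
have sU2 : supp Y2 \subset U by apply: finset.subsetUr.
have ex Y Y' : D Y -> D Y' -> supp Y != supp Y' -> exists2 g, Y g != 0 & Y' g = 0.
  move=> DY DY' ne; have /fintype.subsetPn[g gY gY'] : ~~ (supp Y \subset supp Y').
    by apply: contra ne => /(dp_antichain CD)->; [| exists Y|exists Y'].
  by exists g; [rewrite -in_supp|apply/eqP; rewrite -[_ == _]negbK -in_supp].
have [g Y1g Y2g] := ex _ _ D1 D2 ne12.
have [k Y2k Y1k] : exists2 k, Y2 k != 0 & Y1 k = 0 by apply: ex => //; rewrite eq_sym.
have fU : f \in U by rewrite inU Yf.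
have gU : g \in U by rewrite inU Y1g.
have kU : k \in U by rewrite inU Y2k orbT.
have fg : f != g by apply: contraNneq Yf => E0; rewrite Y1f E0 Y2g.
(* Painting relative to [U]: all elements outside [U] get the colour of the circuits, which confines
   the cocircuits to [U]. *)
have paint x (R : {set E}) : x \in U ->
    (exists X, [/\ C X, X x != 0 & forall y, X y != 0 -> y != x -> y \in U -> y \in R]) \/
    (exists Y, [/\ D Y, Y x != 0, supp Y \subset U
       & forall y, y \in R -> y != x -> Y y = 0]).
  move=> xU; have [[X [CX Xx XR]]|[Y [DY Yx YR]]] := dp_paintingP x (~: U :|: R)%SET.
    left; exists X; split=> // y Xy yx yU.
    by have := XR y Xy yx; rewrite finset.in_setU finset.in_setC yU.
  right; exists Y; split=> //.
    apply/fintype.subsetP => y; rewrite in_supp => Yy.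
    have [->//|/(YR y Yy)] := eqVneq y x.
    by rewrite finset.in_setU finset.in_setC negb_or negbK => /andP[].
  move=> y yR yx; apply/eqP; apply: contraT => Yy.
  by have := YR y Yy yx; rewrite finset.in_setU yR orbT.
have pair X Y x y : C X -> D Y -> supp Y \subset U ->
    (forall z, X z != 0 -> Y z != 0 -> z \in U -> z = x \/ z = y) ->
    X x ** Y x = X y ** Y y.
  move=> CX DY YU P; apply: orthogonal_pair; first exact: dp_orthogonal CD _ _ CX DY.
  move=> z; rewrite !in_supp => Xz Yz; apply: P => //.
  by apply: (fintype.subsetP YU); rewrite in_supp.
(* A circuit through [g] cannot meet [U] within [g] and [f]: since [Y2 g = 0], orthogonality gives
   [X f ** Y2 f = 0], and since [Y1 f = Y2 f], also [X g ** Y1 g = 0]. *)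
have [[X [CX Xg XR]]|[Z0 [DZ0 Z0g Z0U Z0f]]] := paint g [set f]%SET gU.
  have P y : X y != 0 -> y \in U -> y = g \/ y = f.
    by move=> Xy yU; have [|/(XR y Xy)/(_ yU)/set1P] := eqVneq y g; [left|right].
  have := pair X Y1 g f CX D1 sU1 (fun y Xy _ => P y Xy).
  have := pair X Y2 g f CX D2 sU2 (fun y Xy _ => P y Xy).
  rewrite Y2g hmul0r -Y1f => <- /eqP.
  by rewrite hmul_eq0 (negPf Xg) (negPf Y1g).
have {}Z0f : Z0 f = 0 by apply: Z0f => //; apply/set1P.
pose a := hinv (Z0 g) ** Y1 g.
have a0 : a != 0 by rewrite hmul_neq0 hinv_neq0.
pose Z := rscale a Z0.
have DZ : D Z by apply: dp_rscale CD _ _ DZ0 a0.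
have ZU : supp Z \subset U by rewrite supp_rscale.
have Zf : Z f = 0 by rewrite ffunE Z0f hmul0l.
have Zg : Z g = Y1 g by rewrite ffunE /a hmulA hmulV // hmul1l.
have ZY1 h : Y1 h != 0 -> Y2 h = 0 -> Z h = Y1 h.
  move=> Y1h Y2h; have [->//|hg] := eqVneq h g.
  have hU : h \in U by rewrite inU Y1h.
  have [[X [CX Xg XR]]|[Y [DY Yg YU Yh]]] := paint g [set h]%SET gU; last first.
    have {}Yh : Y h = 0 by apply: Yh => //; apply/set1P.
    by have := mod Y2 Y g h D2 DY sU2 YU Y2g Yg hU Y2h; rewrite Yh eqxx.
  have P y : X y != 0 -> y \in U -> y = g \/ y = h.
    by move=> Xy yU; have [|/(XR y Xy)/(_ yU)/set1P] := eqVneq y g; [left|right].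
  have e1 := pair X Y1 g h CX D1 sU1 (fun y Xy _ => P y Xy).
  have := pair X Z g h CX DZ ZU (fun y Xy _ => P y Xy); rewrite Zg e1.
  have /andP[Xh _] : (X h != 0) && (Y1 h != 0) by rewrite -hmul_neq0 -e1 hmul_neq0 Xg.
  by move/(hmul_injl Xh).
have ZY2 h : Y2 h != 0 -> Y1 h = 0 -> Z h = Y2 h.
  move=> Y2h Y1h; have hU : h \in U by rewrite inU Y2h orbT.
  have hg : h != g by apply: contraNneq Y1g => <-; rewrite Y1h.
  have hf : h != f by apply: contraNneq Yf => <-; rewrite Y1h.
  (* On [g], [f], [h] the vectors [Y1], [Y2], [Z] vanish at [h], [g], [f] respectively, so each
     orthogonality relation is an equality of two terms, and the three chain to
     [X h ** Z h = X h ** Y2 h]. *)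
  have [[X [CX Xg XR]]|[Y [DY Yg YU Yfh]]] := paint g [set f; h]%SET gU; last first.
    have Yh : Y h = 0 by apply: Yfh => //; rewrite finset.in_set2 eqxx orbT.
    have {}Yfh : Y f = 0 by apply: Yfh => //; rewrite finset.in_set2 eqxx.
    have Zh : Z h != 0.
      apply/negP => /eqP Zh.
      by have := mod Z Y1 f h DZ D1 ZU sU1 Zf Yf hU Zh; rewrite Y1h eqxx.
    by have := mod Y Z h f DY DZ YU ZU Yh Zh fU Yfh; rewrite Zf eqxx.
  have P y : X y != 0 -> y \in U -> [\/ y = g, y = f | y = h].
    move=> Xy yU; have [|/(XR y Xy)/(_ yU)/set2P[]] := eqVneq y g;
      by [constructor 1|constructor 2|constructor 3].
  have e1 : X g ** Y1 g = X f ** Y1 f.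
    apply: pair => // y Xy Yy yU; case: (P y Xy yU) => E0; [by left|by right|].
    by rewrite E0 Y1h eqxx in Yy.
  have e2 : X f ** Y2 f = X h ** Y2 h.
    apply: pair => // y Xy Yy yU; case: (P y Xy yU) => E0; [|by left|by right].
    by rewrite E0 Y2g eqxx in Yy.
  have e3 : X g ** Z g = X h ** Z h.
    apply: pair => // y Xy Yy yU; case: (P y Xy yU) => E0; [by left| |by right].
    by rewrite E0 Zf eqxx in Yy.
  have e4 : X h ** Z h = X h ** Y2 h by rewrite -e3 -e2 Zg e1 Y1f.
  have /andP[Xh _] : (X h != 0) && (Z h != 0).
    by rewrite -hmul_neq0 -e3 Zg hmul_neq0 Xg.
  exact: hmul_injl Xh e4.
exists Z; split=> // h.
have [Y1h|Y1h] := eqVneq (Y1 h) 0; have [Y2h|Y2h] := eqVneq (Y2 h) 0.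
- suff -> : Z h = 0 by rewrite Y1h Y2h; apply/haddP.
  apply/eqP; apply: contraT => Zh.
  have : h \in U by apply: (fintype.subsetP ZU); rewrite in_supp.
  by rewrite inU Y1h Y2h eqxx.
- by rewrite ZY2 // Y1h haddC hadd0.
- by rewrite ZY1 // Y2h hadd0.
have hU : h \in U by rewrite inU Y1h.
have gh : g != h by apply: contraNneq Y2h => <-; rewrite Y2g.
have kh : k != h by apply: contraNneq Y1h => <-; rewrite Y1k.
(* Here [g] sees only [Y1] and [k] only [Y2]. Orthogonality of the circuit to [Z] on [g], [k], [h]
   becomes the wanted hypersum after multiplication by [X h]. *)
have [[X [CX Xh XR]]|[Y [DY Yh YU Ygk]]] := paint h [set g; k]%SET hU; last first.
  have Yk : Y k = 0 by apply: Ygk => //; rewrite finset.in_set2 eqxx orbT.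
  have {}Ygk : Y g = 0 by apply: Ygk => //; rewrite finset.in_set2 eqxx.
  by have := mod Y Y1 g k DY D1 YU sU1 Ygk Y1g kU Yk; rewrite Y1k eqxx.
have P y : X y != 0 -> y \in U -> [\/ y = g, y = k | y = h].
  move=> Xy yU; have [|/(XR y Xy)/(_ yU)/set2P[]] := eqVneq y h;
    by [constructor 3|constructor 1|constructor 2].
apply/(hadd_pmul2l _ _ _ Xh).
have -> : X h ** Y1 h = X g ** Z g.
  rewrite Zg; apply: pair => // y Xy Yy yU; case: (P y Xy yU) => E0; [by right| |by left].
  by rewrite E0 Y1k eqxx in Yy.
have -> : X h ** Y2 h = X k ** Z k.
  rewrite ZY2 //; apply: pair => // y Xy Yy yU.
  case: (P y Xy yU) => E0; [|by right|by left].
  by rewrite E0 Y2g eqxx in Yy.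
apply: orthogonal_triple; first exact: dp_orthogonal CD _ _ CX DZ.
move=> y; rewrite !in_supp => Xy Zy; apply: P => //.
by apply: (fintype.subsetP ZU); rewrite in_supp.
Qed.

(** A competing [D'] has the same supports as [D], and each of its members is then a right multiple
    of a member of [D]. *)
Lemma dp_cocircuits : cocircuits C = D.
Proof.
have dD : is_dual C D.
  split; [exact: dp_right_matroid|by rewrite dp_dual_circuits|].
  by move=> X Y CX DY _; apply: dp_orthogonal CD _ _ CX DY.
apply/seteqP; split=> [Y [D' [[_ _ scD' _] sD' oD'] D'Y]|Y DY]; last by exists D.
rewrite dp_dual_circuits in sD'.
have [Y' DY' sY] : (@supp H E @` D) (supp Y) by rewrite -sD'; exists Y.
have [|X CX|a a0 ->] := @dp_proportional Y' Y DY'; [by []|exact: oD'|].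
exact: dp_rscale CD _ _ DY' a0.
Qed.

(* Farkas alternative: f is compared with the entries of s only, and the entries
   outside s and f are contracted (in P) or deleted (not in P). *)
Lemma dp_farkas V f (s : seq E) (P : {set E}) : V f != 0 ->
  (exists X, [/\ C X, X f = V f, forall g, g \in s -> g != f -> (X g <= V g)%O
     & forall g, X g != 0 -> g != f -> g \notin s -> g \in P]) \/
  (exists Y, [/\ D Y, Y f != 0,
       forall g, g \in s -> g != f -> (V g ** Y g < V f ** Y f)%O
     & forall g, Y g != 0 -> g != f -> g \notin s -> g \notin P]).
Proof.
move=> Vf; elim: s P => [|e s IH] P.
  have [[X [CX Xf XP]]|[Y [DY Yf YP]]] := dp_paintingP f P; [left|right].
    have a0 : V f ** hinv (X f) != 0 by rewrite hmul_neq0 Vf hinv_neq0.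
    exists (lscale (V f ** hinv (X f)) X); split=> //.
    - exact: dp_lscale CD _ _ CX a0.
    - by rewrite ffunE -hmulA hmulVl // hmul1r.
    - by move=> g; rewrite ffunE hmul_neq0 a0 => Xg gf _; apply: XP.
  by exists Y; split=> // g Yg gf _; apply: YP.
have [ef|ef] := eqVneq e f.
  have sP g : g != f -> (g \in e :: s) = (g \in s).
    by move=> gf; rewrite inE ef (negPf gf).
  have [[X [CX Xf Xs XP]]|[Y [DY Yf Ys YP]]] := IH P; [left|right].
    by exists X; split=> // g => [gs gf|Xg gf gs]; rewrite sP // in gs; auto.
  by exists Y; split=> // g => [gs gf|Yg gf gs]; rewrite sP // in gs; auto.
(* With [e] barred from the circuit, an answer [X] vanishes at [e] unless [e] recurs in [s], so the
   comparison at [e] holds. The next case bars [e] from the cocircuit. *)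
have [[X [CX Xf Xs XP]]|[Y1 [DY1 Y1f Y1s Y1P]]] := IH (P :\ e).
  left; exists X; split=> // g.
    rewrite inE => /predU1P[->|/Xs//] _; have [->//|Xe] := eqVneq (X e) 0.
    have [es|es] := boolP (e \in s); first exact: Xs.
    by have := XP e Xe ef es; rewrite !inE eqxx.
  rewrite inE negb_or => Xg gf /andP[ge gs].
  by have := XP g Xg gf gs; rewrite !inE ge.
have [[X1 [CX1 X1f X1s X1P]]|[Y [DY Yf Ys YP]]] := IH (e |: P); last first.
  right; exists Y; split=> // g.
    rewrite inE => /predU1P[->|/Ys//] _; have [Ye|Ye] := eqVneq (Y e) 0.
      by rewrite Ye hmul0r lt0h hmul_neq0 Vf.
    have [es|es] := boolP (e \in s); first exact: Ys.
    by have := YP e Ye ef es; rewrite !inE eqxx.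
  rewrite inE negb_or => Yg gf /andP[ge gs].
  by have := YP g Yg gf gs; rewrite !inE (negPf ge).
have [X1e|X1e] := leP (X1 e) (V e).
  left; exists X1; split=> // g.
    by rewrite inE => /predU1P[->//|/X1s].
  rewrite inE negb_or => X1g gf /andP[ge gs].
  by have := X1P g X1g gf gs; rewrite !inE (negPf ge).
have [Y1e|Y1e] := ltP (V e ** Y1 e) (V f ** Y1 f).
  right; exists Y1; split=> // g.
    by rewrite inE => /predU1P[->//|/Y1s].
  rewrite inE negb_or => Y1g gf /andP[ge gs].
  by have := Y1P g Y1g gf gs; rewrite !inE ge.
have Y1e0 : Y1 e != 0.
  apply: contraTneq Y1e => ->.
  by rewrite hmul0r -ltNge lt0h hmul_neq0 Vf.
(* Both remaining candidates fail at [e]. Orthogonality of [X1] and [Y1] then asks for another [g]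
   with a product at least as large, which is excluded for [g = f], for [g] in [s], and elsewhere
   because [X1] needs [g] in [P] and [Y1] needs it outside. *)
have lt : (V f ** Y1 f < X1 e ** Y1 e)%O.
  by apply: le_lt_trans Y1e _; rewrite hlt_pmul2r.
have /orthogonalP/(_ e)[|g ge le] := dp_orthogonal CD CX1 DY1.
  by rewrite -lt0h (le_lt_trans _ lt).
have {}lt := lt_le_trans lt le.
have [gf|gf] := eqVneq g f; first by rewrite gf X1f ltxx in lt.
have [gs|gs] := boolP (g \in s).
  have := le_lt_trans (hle_mul2r (Y1 g) (X1s g gs gf)) (Y1s g gs gf).
  by rewrite ltNge (ltW lt).
have : X1 g ** Y1 g != 0 by rewrite -lt0h (le_lt_trans _ lt).
rewrite hmul_neq0 => /andP[X1g Y1g].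
have := X1P g X1g gf gs; have := Y1P g Y1g gf gs.
by rewrite !inE (negPf ge) /= => /negPf->.
Qed.

Lemma dp_vector_span V f : (forall Y, D Y -> orthogonal V Y) -> V f != 0 ->
  exists X, [/\ C X, X f = V f & forall g, (X g <= V g)%O].
Proof.
move=> orthV Vf.
have [[X [CX Xf XV _]]|[Y [DY Yf YV _]]] := dp_farkas (enum E) finset.set0 Vf.
  exists X; split=> // g; have [->|gf] := eqVneq g f; first by rewrite Xf.
  by apply: XV; rewrite ?mem_enum.
have /orthogonalP/(_ f)[|g gf] := orthV Y DY; first by rewrite hmul_neq0 Vf.
by rewrite leNgt YV ?mem_enum.
Qed.

End DualPairTheory.

(** An index dominating [f] for the circuit that agrees with [V] at [f] also dominates it for [V],
    as that circuit lies below [V] and multiplication is monotone. *)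
Lemma span_orthogonal C V Y :
    (forall f, V f != 0 -> exists X, [/\ C X, X f = V f & forall g, (X g <= V g)%O]) ->
    (forall X, C X -> orthogonal X Y) ->
  orthogonal V Y.
Proof.
move=> span orthY; apply/orthogonalP => f nz; move: (nz).
rewrite hmul_neq0 => /andP[/span[X [CX Xf XV]] _].
have /orthogonalP/(_ f) := orthY X CX; rewrite Xf => /(_ nz)[g gf le].
by exists g => //; apply: le_trans le (hle_mul2r _ (XV g)).
Qed.

End DualPairs.

(** * Deletion and contraction of dual pairs, and their vectors *)

Section MinorsOfDualPairs.
Variables (d : Order.disp_t) (Gamma : orderedGroupType d) (E : finType) (e : E).
Local Notation H := (Gmax Gamma).
Local Notation "0" := (hzero H).
Local Notation "x ** y" := (@hmul H x y) (at level 40, left associativity).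
Local Notation vec := {ffun E -> H}.
Implicit Types (C D : set vec) (X Y Z V : vec).

Lemma supp_support_minimal (F : finType) (Q : set {ffun F -> H}) :
  @supp H F @` support_minimal Q = min_sets (@supp H F @` Q).
Proof.
have nz (X : {ffun F -> H}) : X <> zerov H F <-> supp X != finset.set0.
  by rewrite supp_eq0; split=> [?|/eqP//]; apply/eqP.
apply/seteqP; split=> [_ [X [QX /nz X0 minX] <-]|_ [[X QX <-] X0 minX]].
  split; [by exists X|exact: X0|].
  by move=> _ [Y QY <-] /nz; apply: minX.
exists X => //; split=> //; first by apply/nz.
by move=> Y QY /nz; apply: minX; exists Y.
Qed.

Lemma restr_lscale a X : restr e (lscale a X) = lscale a (restr e X).
Proof. by apply/ffunP => x; rewrite !ffunE. Qed.

Lemma restr_rscale a X : restr e (rscale a X) = rscale a (restr e X).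
Proof. by apply/ffunP => x; rewrite !ffunE. Qed.

Lemma support_minimal_scale (F : finType) (Q : set {ffun F -> H})
    (s : {ffun F -> H} -> {ffun F -> H}) :
  (forall X : {ffun F -> H}, Q X -> Q (s X)) ->
  (forall X : {ffun F -> H}, supp (s X) = supp X) ->
  forall X : {ffun F -> H}, support_minimal Q X -> support_minimal Q (s X).
Proof.
move=> Qs ss X [QX X0 minX]; split; [exact: Qs| |by rewrite ss].
by move/eqP: X0; rewrite -supp_eq0 -ss supp_eq0 => /eqP.
Qed.

Lemma ex_del (f : E) : f != e -> exists x : del e, val x = f.
Proof. by move=> fe; exists (exist _ f fe). Qed.

Lemma orthogonal_restr X Y : X e ** Y e = 0 ->
  orthogonal (restr e X) (restr e Y) <-> orthogonal X Y.
Proof.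
move=> XYe; split=> /orthogonalP orth; apply/orthogonalP => f nz.
  have [|x xf] := @ex_del f; first by apply: contraNneq nz => ->; rewrite XYe.
  subst f; have := orth x; rewrite !ffunE => /(_ nz)[y yx]; rewrite !ffunE.
  by exists (val y); rewrite ?val_eqE.
rewrite !ffunE in nz *; have [g gf le] := orth (val f) nz.
have [|y yg] := @ex_del g.
  apply: contraNneq nz => ge; move: le; by rewrite ge XYe leh0.
by exists y; rewrite -?val_eqE ?ffunE yg.
Qed.

Lemma restr_zero X : X e = 0 -> restr e X = zerov H _ -> X = zerov H E.
Proof.
move=> Xe X0; apply/ffunP => f; rewrite ffunE.
have [->//|/ex_del[x <-]] := eqVneq f e.
by have := congr1 (fun Z : {ffun del e -> H} => Z x) X0; rewrite !ffunE.
Qed.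

Lemma restr_supp_sub X Y : supp (restr e X) \subset supp (restr e Y) ->
  forall f, f != e -> X f != 0 -> Y f != 0.
Proof.
move=> /fintype.subsetP sub f /ex_del[x <-] Xx.
by have := sub x; rewrite !in_supp !ffunE; apply.
Qed.

Lemma painting_minor C D : painting (@supp H E @` C) (@supp H E @` D) ->
  painting (@supp H _ @` slice C e) (@supp H _ @` proj D e).
Proof.
(* Keeping [e] out of [R'] forces the circuit to vanish at [e] and leaves the cocircuit free
   there. *)
move=> pt x R; pose R' := [set val y | y in R]%SET.
have inR' (y : del e) : (val y \in R') = (y \in R) by rewrite mem_imset //; apply: val_inj.
have eR' : e \notin R'.
  by apply/imsetP => -[y _ ey]; have := valP y; rewrite /= -ey eqxx.
have [[_ [[X CX <-] xX XR]]|[_ [[Y DY <-] xY YR]]] := pt (val x) R'; [left|right].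
  exists (supp (restr e X)); split.
  - exists (restr e X) => //; exists X => //; split=> //.
    apply/eqP; rewrite -[_ == _]negbK -in_supp; apply: contra eR' => eX.
    by apply: XR => //; rewrite eq_sym (valP x).
  - by rewrite in_supp ffunE -in_supp.
  - by move=> y; rewrite in_supp ffunE -in_supp -inR' -val_eqE; apply: XR.
exists (supp (restr e Y)); split.
- by exists (restr e Y) => //; exists Y.
- by rewrite in_supp ffunE -in_supp.
- by move=> y; rewrite in_supp ffunE -in_supp -inR' -val_eqE; apply: YR.
Qed.

Lemma antichain_slice D : antichain (@supp H E @` D) ->
  antichain (@supp H _ @` slice D e).
Proof.
move=> anti _ _ [_ [X [DX Xe] <-] <-] [_ [Y [DY Ye] <-] <-] sub.
have E0 : supp X = supp Y.
  apply: anti; [by exists X|by exists Y|]; apply: supp_sub => f.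
  by have [->|fe] := eqVneq f e; [rewrite Xe eqxx|apply: restr_supp_sub sub _ fe].
by apply/setP => x; rewrite !in_supp !ffunE -!in_supp E0.
Qed.

Variables (C D : set vec) (CD : dual_pair C D).

Lemma slice_zero (Q : set vec) : ~ Q (zerov H E) -> ~ slice Q e (zerov H _).
Proof. by move=> Q0 [X [QX Xe] /(restr_zero Xe) X0]; rewrite X0 in QX. Qed.

(** Painting and orthogonality already hold between [slice C e] and [proj D e]; [painting_min] then
    permits passing to support-minimal elements. *)
Lemma dual_pair_deletion : dual_pair (deletion C e) (contraction D e).
Proof.
have orth (X Y : {ffun del e -> H}) : slice C e X -> proj D e Y -> orthogonal X Y.
  move=> [{}X [CX Xe] <-] [{}Y DY <-]; apply/orthogonal_restr.
    by rewrite Xe hmul0l.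
  exact: dp_orthogonal CD _ _ CX DY.
split.
- exact: slice_zero (dp_circ0 CD).
- by case.
- move=> _ a [X [CX Xe] <-] a0; rewrite -restr_lscale; exists (lscale a X) => //.
  by split; [apply: dp_lscale CD _ _ CX a0|rewrite ffunE Xe hmul0r].
- move=> Y a DY a0; apply: support_minimal_scale DY => [_ [Y' DY' <-]|Y'].
    by rewrite -restr_rscale; exists (rscale a Y') => //; apply: dp_rscale CD _ _ DY' a0.
  exact: supp_rscale.
- by rewrite supp_support_minimal; apply: min_sets_antichain.
- rewrite supp_support_minimal; apply: painting_min.
    by move=> _ _ x [X CX <-] [Y DY <-]; apply: orthogonal_crossing; apply: orth.
  exact: painting_minor (dp_painting CD).
- by move=> X Y CX [DY _ _]; apply: orth.
Qed.

Lemma dual_pair_contraction : dual_pair (contraction C e) (slice D e).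
Proof.
have orth (X Y : {ffun del e -> H}) : proj C e X -> slice D e Y -> orthogonal X Y.
  move=> [{}X CX <-] [{}Y [DY Ye] <-]; apply/orthogonal_restr.
    by rewrite Ye hmul0r.
  exact: dp_orthogonal CD _ _ CX DY.
split.
- by case.
- exact: slice_zero (dp_cocirc0 CD).
- move=> X a CX a0; apply: support_minimal_scale CX => [_ [X' CX' <-]|X'].
    by rewrite -restr_lscale; exists (lscale a X') => //; apply: dp_lscale CD _ _ CX' a0.
  exact: supp_lscale.
- move=> _ a [Y [DY Ye] <-] a0; rewrite -restr_rscale; exists (rscale a Y) => //.
  by split; [apply: dp_rscale CD _ _ DY a0|rewrite ffunE Ye hmul0l].
- exact: antichain_slice (dp_antichain CD).
- rewrite supp_support_minimal; apply/painting_sym/painting_min.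
    move=> _ _ x [Y DY <-] [X CX <-] xY xX.
    by have [y [? ? ?]] := orthogonal_crossing (orth _ _ CX DY) xX xY; exists y.
  exact/painting_minor/painting_sym/(dp_painting CD).
- by move=> X Y [CX _ _]; apply: orth.
Qed.

(* The lifted vector takes at e the largest value of the lifted circuits. *)
Lemma vectors_contraction : vectors (contraction C e) = proj (vectors C) e.
Proof.
rewrite /vectors (dp_cocircuits CD) (dp_cocircuits dual_pair_contraction).
apply/seteqP; split=> [V' orthV'|_ [V orthV <-] _ [Y [DY Ye] <-]]; last first.
  by apply/orthogonal_restr; [rewrite Ye hmul0r|apply: orthV].
have lift x : exists X, V' x != 0 ->
    [/\ C X, X (val x) = V' x & forall y, (X (val y) <= V' y)%O].
  have [_|Vx] := eqVneq (V' x) 0; first by exists (zerov H E).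
  have [_ [[[X CX <-] _ _] Xx XV]] :=
    dp_vector_span dual_pair_contraction orthV' Vx.
  by exists X => _; split=> //; [rewrite -Xx ffunE|move=> y; have := XV y; rewrite ffunE].
have [X XP] := choice lift.
(* As an upper bound, [m] puts every lifted circuit below [V]; when nonzero it is attained, which
   supplies a circuit equal to [V] at [e]. *)
have [m [mb mi]] := seq_maxP [seq X x e | x <- enum (del e) & V' x != 0].
pose V : vec := [ffun f => if insub f is Some x then V' x else m].
have Ve : V e = m by rewrite ffunE insubF // eqxx.
have Vx (x : del e) : V (val x) = V' x by rewrite ffunE valK.
have XV x : V' x != 0 -> forall f, (X x f <= V f)%O.
  move=> Vx0 f; have [_ _ le] := XP x Vx0.
  have [->|/ex_del[y <-]] := eqVneq f e; last by rewrite Vx.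
  by rewrite Ve; apply: mb; apply: map_f; rewrite mem_filter Vx0 mem_enum.
exists V; last by apply/ffunP => x; rewrite ffunE Vx.
move=> Y DY; apply: (@span_orthogonal _ _ _ C) => [f Vf|Z CZ]; last first.
  exact: dp_orthogonal CD _ _ CZ DY.
have [fe|/ex_del[x xf]] := eqVneq f e; last first.
  subst f; rewrite Vx in Vf *; have [CX Xx _] := XP x Vf.
  by exists (X x); split=> //; apply: XV.
subst f; rewrite Ve in Vf *; case: mi => [m0|]; first by rewrite m0 eqxx in Vf.
case/mapP => x; rewrite mem_filter => /andP[Vx0 _] mE.
by have [CX Xx _] := XP x Vx0; exists (X x); split=> //; apply: XV.
Qed.

(** Extension by zero suffices, since circuits of the deletion come from circuits vanishing at
    [e]. *)
Lemma vectors_deletion : vectors (deletion C e) = slice (vectors C) e.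
Proof.
rewrite /vectors (dp_cocircuits CD) (dp_cocircuits dual_pair_deletion).
apply/seteqP; split=> [V' orthV'|_ [V [orthV Ve] <-] _ [[Y DY <-] _ _]]; last first.
  by apply/orthogonal_restr; [rewrite Ve hmul0l|apply: orthV].
pose V : vec := [ffun f => if insub f is Some x then V' x else 0].
have Ve : V e = 0 by rewrite ffunE insubF // eqxx.
have Vx (x : del e) : V (val x) = V' x by rewrite ffunE valK.
exists V; last by apply/ffunP => x; rewrite ffunE Vx.
split=> // Y DY; apply: (@span_orthogonal _ _ _ C) => [f Vf|Z CZ]; last first.
  exact: dp_orthogonal CD _ _ CZ DY.
have [|x xf] := @ex_del f; first by apply: contraNneq Vf => ->; rewrite Ve.
subst f; rewrite Vx in Vf *.
have [_ [[X [CX Xe] <-] Xx XV]] := dp_vector_span dual_pair_deletion orthV' Vf.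
exists X; split=> // [|f]; first by rewrite -Xx ffunE.
have [->|/ex_del[y <-]] := eqVneq f e; first by rewrite Xe.
by rewrite Vx; have := XV y; rewrite ffunE.
Qed.

End MinorsOfDualPairs.

(** * Circuits of a left matroid and their restrictions off [e] *)

Section LeftMatroids.
Variables (d : Order.disp_t) (Gamma : orderedGroupType d).
Local Notation H := (Gmax Gamma).
Local Notation "0" := (hzero H).
Local Notation "x ** y" := (@hmul H x y) (at level 40, left associativity).
Local Notation circuits C := (@supp H _ @` C).

Lemma hadd_le (a b c m : H) : hadd a b c -> (a <= m)%O -> (b <= m)%O -> (c <= m)%O.
Proof.
move=> /haddP/or3P[] /andP[/eqP E le] am bm; last by rewrite -E.
  exact: le_trans am.
by rewrite -E.
Qed.

Section Circuits.
Variables (E : finType) (C : set {ffun E -> H}) (hC : left_matroid C).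
Implicit Types (X Y Z : {ffun E -> H}) (e f g : E).

Lemma matroid_neq0 X : C X -> exists f, X f != 0.
Proof.
move=> CX; have [C0 _ _ _] := hC; apply: contrapT => no; apply: C0.
suff <- : X = zerov H E by [].
by apply/ffunP => f; rewrite ffunE; apply/eqP; apply: contraT => Xf; case: no; exists f.
Qed.

Lemma matroid_antichain : antichain (circuits C).
Proof.
move=> _ _ [X CX <-] [Y CY <-] sub; have [_ _ inc _] := hC.
by have [a a0 ->] := inc X Y CX CY sub; rewrite supp_lscale.
Qed.

Lemma matroid_weak_elimination : weak_elimination (circuits C).
Proof.
apply: modular_weak_elimination => _ _ x [X CX <-] [Y CY <-] mod.
rewrite !in_supp => Xx Yx; have [_ sc _ el] := hC.
(* Scaling makes the entries at [x] equal, which is the hypothesis of elimination because [hopp] is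
   the identity. *)
pose a := X x ** hinv (Y x); have a0 : a != 0 by rewrite hmul_neq0 Xx hinv_neq0.
have [|||Z [CZ Zx XYZ]] := el X (lscale a Y) x CX (sc _ _ CY a0); rewrite ?supp_lscale //.
  by rewrite ffunE -hmulA hmulVl // hmul1r.
exists (supp Z); split; [by exists Z|by rewrite in_supp Zx eqxx|].
by have := haddv_supp XYZ; rewrite supp_lscale.
Qed.

Lemma matroid_strong_elimination : strong_elimination (circuits C).
Proof.
exact: weak_strong_elimination matroid_antichain matroid_weak_elimination.
Qed.

Lemma matroid_sub X Y f : C X -> C Y -> (forall g, X g != 0 -> Y g != 0) ->
  Y f != 0 -> X f != 0.
Proof.
move=> CX CY sub; rewrite -!in_supp.
by have -> := matroid_antichain (imageP _ CX) (imageP _ CY) (supp_sub sub).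
Qed.

Variable e : E.

(** Off [e], no circuit lies strictly inside a circuit through [e], since it would then lie inside
    the whole of it. The entry at [f] keeps the restriction nonzero. *)
Lemma contraction_circuit Z f : C Z -> Z e != 0 -> f != e -> Z f != 0 ->
  contraction C e (restr e Z).
Proof.
move=> CZ Ze fe Zf; split; first by exists Z.
  move=> Z0; have [x xf] := ex_del fe.
  have := congr1 (fun W : {ffun del e -> H} => W x) Z0; rewrite !ffunE xf.
  by apply/eqP.
move=> _ [Y CY <-] _; apply/negP => /fintype.properP[sub [x]].
rewrite !in_supp !ffunE => Zx; rewrite (@matroid_sub Y Z) // => g Yg.
by have [->//|ge] := eqVneq g e; apply: restr_supp_sub sub _ ge Yg.
Qed.

(* If X misses e but spans it, scale a circuit Z1 through e in X + e avoiding f to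
   touch X from below at some g; eliminating g from X and Z1 keeps the entry at f. *)
Lemma circuit_contraction_span X f : C X -> f != e -> X f != 0 ->
  exists Z, [/\ C Z, contraction C e (restr e Z), Z f = X f
    & forall g, g != e -> (Z g <= X g)%O].
Proof.
move=> CX fe Xf; have [Q|nQ] := EM (contraction C e (restr e X)).
  by exists X; split.
have Xe : X e = 0.
  by apply/eqP; apply: contrapT => /negP Xe; apply: nQ; apply: contraction_circuit Xf.
have nzX : restr e X <> zerov H _.
  by move=> /(restr_zero Xe) X0; rewrite X0 ffunE eqxx in Xf.
(* Such a [Y] must pass through [e], or it would sit strictly inside the circuit [X]. *)
have [Y [CY nzY /fintype.properP[sub [x Xx Yx]]]] : exists Y,
    [/\ C Y, restr e Y <> zerov H _ & supp (restr e Y) \proper supp (restr e X)].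
  apply: contrapT => no; apply: nQ; split=> //; first by exists X.
  by move=> _ [Y CY <-] nzY; apply/negP => pr; apply: no; exists Y.
have {}sub := restr_supp_sub sub.
rewrite !in_supp !ffunE negbK in Xx Yx.
have Ye : Y e != 0.
  apply/negP => /eqP Ye; suff : Y (val x) != 0 by rewrite (eqP Yx) eqxx.
  apply: (@matroid_sub Y X) => // g Yg; apply: sub => //.
  by apply: contraNneq Yg => ->; rewrite Ye.
have noloop Z : C Z -> Z e != 0 -> exists2 g, g != e & Z g != 0.
  move=> CZ Ze; apply: contrapT => no; apply: nzY; apply/ffunP => y; rewrite !ffunE.
  apply/eqP; apply: contraT => Yy; exfalso; apply: (no).
  exists (val y); first exact: (valP y).
  apply: (@matroid_sub Z Y) => // g Zg; suff -> : g = e by [].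
  by apply/eqP; apply: contraT => ge; exfalso; apply: (no); exists g.
have [Z1 [CZ1 Z1e Z1f Z1X]] : exists Z1, [/\ C Z1, Z1 e != 0, Z1 f = 0
    & forall g, g != e -> Z1 g != 0 -> X g != 0].
  have [Yf|Yf] := eqVneq (Y f) 0; first by exists Y.
  have [||||||_ [[W CW <-] fW eW WU]] :=
    @matroid_strong_elimination (supp Y) (supp X) f e.
  - by exists Y.
  - by exists X.
  - by rewrite in_supp.
  - by rewrite in_supp.
  - by rewrite in_supp.
  - by rewrite in_supp Xe eqxx.
  exists W; split=> //; first by rewrite -in_supp.
    by apply/eqP; move: fW; rewrite in_supp negbK.
  move=> g ge Wg; have := fintype.subsetP WU g; rewrite finset.in_setU !in_supp.
  by move=> /(_ Wg)/orP[/(sub g ge)|].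
have [g0 g0e Z1g0] := noloop Z1 CZ1 Z1e.
(* Left scaling multiplies these ratios on the left, so scaling by the inverse of the largest one
   puts [Z1] below [X] off [e], with equality at the maximiser. *)
pose F g := Z1 g ** hinv (X g).
have [g Xg maxg] := @arg_maxP _ _ _ f (fun g => X g != 0) F Xf.
have F0 : F g != 0.
  rewrite -lt0h; apply: lt_le_trans (maxg g0 (Z1X _ g0e Z1g0)).
  by rewrite lt0h hmul_neq0 Z1g0 hinv_neq0 ?Z1X.
pose Z2 := lscale (hinv (F g)) Z1; have Fi0 := hinv_neq0 F0.
have [_ sc _ el] := hC; have CZ2 : C Z2 by apply: sc.
have Z2g : Z2 g = X g.
  rewrite ffunE; apply: (@hmul_injr _ _ (hinv (X g))); first exact: hinv_neq0.
  by rewrite -hmulA -/(F g) hmulVl // hmulV.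
have Z2X h : h != e -> (Z2 h <= X h)%O.
  move=> he; have [Xh|Xh] := eqVneq (X h) 0.
    suff -> : Z2 h = 0 by []; rewrite ffunE; suff -> : Z1 h = 0 by rewrite hmul0r.
    by apply/eqP; apply: contraT => /(Z1X _ he); rewrite Xh eqxx.
  rewrite -(hle_pmul2r _ _ (hinv_neq0 Xh)) ffunE -hmulA -/(F h) hmulV //.
  by rewrite -(hmulVl F0) hle_pmul2l //; apply: maxg.
have Z2e : Z2 e != 0 by rewrite ffunE hmul_neq0 Fi0.
have Z2f : Z2 f = 0 by rewrite ffunE Z1f hmul0r.
(* The union is [X] with [e] added, and a circuit in it avoiding [e] is [X] itself. Two distinct
   circuits inside it thus cover it: if both contain [e], eliminating [e] produces [X] below their
   union. *)
have mod : modular_pair (circuits C) (supp X) (supp Z2).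
  split; first by apply: contraTneq Z2e => E0; rewrite -in_supp -E0 in_supp Xe eqxx.
  move=> A B CA CB AB; apply/negP => /fintype.properP[sAB [p pU pAB]].
  have inX W : circuits C W -> W \subset A :|: B -> e \notin W -> W = supp X.
    move=> CW WAB eW; apply: matroid_antichain => //.
    apply/fintype.subsetP => q qW.
    have := fintype.subsetP sAB q (fintype.subsetP WAB q qW).
    rewrite finset.in_setU => /orP[//|]; rewrite !in_supp ffunE hmul_neq0 => /andP[_].
    by apply: Z1X; apply: contraNneq eW => <-.
  have XAB : supp X \subset A :|: B /\ e \in A :|: B.
    have [eA|eA] := boolP (e \in A); have [eB|eB] := boolP (e \in B).
    - have [W [CW eW WU]] := matroid_weak_elimination CA CB AB eA eB.
      by rewrite -(inX W CW WU eW) WU finset.in_setU eA.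
    - by rewrite -(inX B CB (finset.subsetUr _ _) eB) finset.subsetUr finset.in_setU eA.
    - by rewrite -(inX A CA (finset.subsetUl _ _) eA) finset.subsetUl finset.in_setU eB orbT.
    - have := inX B CB (finset.subsetUr _ _) eB.
      by rewrite -(inX A CA (finset.subsetUl _ _) eA) => E0; rewrite E0 eqxx in AB.
  case: XAB => /fintype.subsetP XAB eAB; case/negP: pAB.
  have [->//|pe] := eqVneq p e; apply: XAB; move: pU.
  rewrite finset.in_setU => /orP[//|]; rewrite !in_supp ffunE hmul_neq0 => /andP[_].
  exact: Z1X.
have [||W [CW Wg XZW]] := el X Z2 g CX CZ2 mod; [by rewrite Z2g|by []|].
have Wf : W f = X f by have := XZW f; rewrite Z2f hadd0.
have We : W e != 0 by have := XZW e; rewrite Xe haddC hadd0 => ->.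
exists W; split=> //; first by apply: (@contraction_circuit W f); rewrite ?Wf.
by move=> h he; apply: hadd_le (XZW h) _ _ => //; apply: Z2X.
Qed.
End Circuits.
End LeftMatroids.

(** * Contractions are left matroids; existence of the dual *)

Section Duality.
Variables (d : Order.disp_t) (Gamma : orderedGroupType d).
Local Notation H := (Gmax Gamma).
Local Notation "0" := (hzero H).
Local Notation "x ** y" := (@hmul H x y) (at level 40, left associativity).
Local Notation circuits C := (@supp H _ @` C).

Section Contraction.
Variables (E : finType) (C : set {ffun E -> H}) (hC : left_matroid C) (e : E).
Implicit Types (X Y Z W : {ffun E -> H}) (S T : {set del e}).

Local Notation Qs := (circuits (contraction C e)).

(** Off [e] the support of [Z] is a union of supports of contraction circuits; if only [S] fits, the
    union is [S]. *)
Lemma circuit_contraction_unique Z f S : C Z -> f != e -> Z f != 0 ->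
  (forall T, Qs T -> T \subset supp (restr e Z) -> T = S) -> supp (restr e Z) = S.
Proof.
move=> CZ fe Zf uniqS.
have span x : x \in supp (restr e Z) -> x \in S /\ S \subset supp (restr e Z).
  rewrite in_supp ffunE => Zx; have [W [CW QW Wx WZ]] :=
    circuit_contraction_span hC CZ (valP x) Zx.
  have sub : supp (restr e W) \subset supp (restr e Z).
    apply: supp_sub => y; rewrite !ffunE -!lt0h => Wy.
    exact: lt_le_trans Wy (WZ _ (valP y)).
  have <- : supp (restr e W) = S by apply: uniqS => //; exists (restr e W).
  by rewrite in_supp ffunE Wx.
apply/eqP; rewrite finset.eqEsubset; apply/andP; split.
  by apply/fintype.subsetP => x /span[].
by have [x xf] := ex_del fe; have [|//] := span x; rewrite in_supp ffunE xf.
Qed.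

Lemma eq_off_circuit X Y : C X -> C Y -> supp (restr e X) = supp (restr e Y) ->
  supp X = supp Y.
Proof.
move=> CX CY sXY.
have le X' Y' : C X' -> C Y' -> supp (restr e X') = supp (restr e Y') ->
    (X' e != 0 -> Y' e != 0) -> supp X' = supp Y'.
  move=> CX' CY' E0 Xe; apply: (matroid_antichain hC); [by exists X'|by exists Y'|].
  apply: supp_sub => g; have [->//|ge] := eqVneq g e.
  by apply: restr_supp_sub ge; rewrite E0.
have [Xe|Xe] := eqVneq (X e) 0; first by apply: le => //; rewrite Xe eqxx.
by apply/esym; apply: le.
Qed.

(** A modular pair of the contraction lifts to a modular pair of [C], where elimination is
    available. The restricted result is again a circuit because only one contraction circuit fits
    below it. *)
Lemma contraction_left_matroid : left_matroid (contraction C e).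
Proof.
have [_ sc inc el] := hC.
have Qanti : antichain Qs.
  by rewrite supp_support_minimal; apply: min_sets_antichain.
split; [by case| | |].
- move=> X' a QX a0; apply: support_minimal_scale QX => [_ [X CX <-]|X].
    by rewrite -restr_lscale; exists (lscale a X) => //; apply: sc.
  exact: supp_lscale.
- move=> X' Y' QX QY sub.
  have sXY : supp X' = supp Y' by apply: Qanti sub; [exists X'|exists Y'].
  case: QX QY sXY {sub} => -[X CX <-] _ _ [[Y CY <-] _ _] /(eq_off_circuit CX CY) E0.
  have [|a a0 ->] := inc X Y CX CY; first by rewrite E0.
  by exists a => //; rewrite restr_lscale.
move=> X' Y' f QX QY [neXY modXY] XYf Xf.
have [[X CX X'E] nzX _] := QX; have [[Y CY Y'E] nzY _] := QY.
pose U := supp X' :|: supp Y'.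
have mod S T z : Qs S -> Qs T -> S != T -> S \subset U -> T \subset U -> z \in U ->
    (z \in S) || (z \in T).
  move=> QS QT ST SU TU zU; apply: contraT => nz; have := modXY S T QS QT ST.
  case/negP; apply/fintype.properP; split; first by rewrite finset.subUset SU.
  by exists z; rewrite // finset.in_setU.
have UE (x : del e) : (x \in U) = (val x \in supp X :|: supp Y).
  by rewrite !finset.in_setU -X'E -Y'E !in_supp !ffunE.
have subU W : supp W \subset supp X :|: supp Y -> supp (restr e W) \subset U.
  move=> /fintype.subsetP WU; apply/fintype.subsetP => x.
  by rewrite in_supp ffunE UE -in_supp; apply: WU.
(* A circuit supported at [e] alone would exclude [e] from [X] and [Y], whose restrictions are
   nonzero, and hence from their union. *)
have noloop W : C W -> supp W \subset supp X :|: supp Y -> exists2 g, g != e & W g != 0.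
  move=> CW /fintype.subsetP WU; apply: contrapT => no.
  have We g : W g != 0 -> g = e.
    by move=> Wg; apply/eqP; apply: contraT => ge; exfalso; apply: (no); exists g.
  have [g Wg] := matroid_neq0 hC CW; have {}Wg : W e != 0 by rewrite -(We g Wg).
  have bad Z : C Z -> restr e Z <> zerov H _ -> Z e = 0.
    move=> CZ nzZ; apply/eqP; apply: contraT => Ze; exfalso; apply: nzZ.
    apply/ffunP => y; rewrite !ffunE; apply/eqP; apply: contraT => Zy.
    have /We ye : W (val y) != 0.
      by apply: (matroid_sub hC CW CZ) => // h /We->.
    by have := valP y; rewrite /= ye eqxx.
  have := WU e; rewrite finset.in_setU !in_supp Wg bad ?X'E //.
  by rewrite bad ?Y'E // eqxx => /(_ isT).
have modC : modular_pair (circuits C) (supp X) (supp Y).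
  split.
    apply: contraNneq neXY => E0; rewrite -X'E -Y'E; apply/eqP/setP => x.
    by rewrite !in_supp !ffunE -!in_supp E0.
  move=> _ _ [P CP <-] [R CR <-] nePR; apply/negP => /fintype.properP[].
  rewrite finset.subUset => /andP[PU RU] [p pU].
  rewrite finset.in_setU negb_or => /andP[pP pR].
  have [g ge Pg] := noloop P CP PU.
  (* If [p] differs from [e], all contraction circuits below [P] or [R] miss the same element of
     [U], so [mod] leaves only one of them and [P], [R] get equal supports. *)
  have [pe|/ex_del[x xp]] := eqVneq p e; last first.
    have [S QS SP] : exists2 S, Qs S & S \subset supp (restr e P).
      have [Z [CZ QZ _ ZP]] := circuit_contraction_span hC CP ge Pg.
      exists (supp (restr e Z)); first by exists (restr e Z).
      apply: supp_sub => y; rewrite !ffunE -!lt0h => Zy.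
      exact: lt_le_trans Zy (ZP _ (valP y)).
    have miss W T : p \notin supp W -> T \subset supp (restr e W) -> x \notin T.
      move=> pW TW; apply: contra pW => /(fintype.subsetP TW).
      by rewrite in_supp ffunE xp -in_supp.
    have uniqS W : supp W \subset supp X :|: supp Y -> p \notin supp W ->
        forall T, Qs T -> T \subset supp (restr e W) -> T = S.
      move=> WU pW T QT TW; apply/eqP; apply: contraT => TS.
      have := mod T S x QT QS TS; rewrite (negPf (miss _ _ pW TW)).
      rewrite (negPf (miss _ _ pP SP)) UE xp pU /=; apply=> //.
        exact: fintype.subset_trans TW (subU _ WU).
      exact: fintype.subset_trans SP (subU _ PU).
    have [h he Rh] := noloop R CR RU.
    have sP := circuit_contraction_unique CP ge Pg (uniqS P PU pP).
    have sR := circuit_contraction_unique CR he Rh (uniqS R RU pR).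
    by case/negP: nePR; apply/eqP; apply: eq_off_circuit => //; rewrite sP sR.
  (* If [p = e], both [P] and [R] avoid [e]. Circuits [N'] through [e] and [W] avoiding [e], both
     missing [g], are built inside the union; [mod] makes them agree off [e], hence have equal
     supports, a contradiction at [e]. *)
  subst p; have [x xg] := ex_del ge.
  have [N [CN Ne NU]] : exists N, [/\ C N, N e != 0 & supp N \subset supp X :|: supp Y].
    move: pU; rewrite finset.in_setU !in_supp => /orP[Xe|Ye].
      by exists X; rewrite finset.subsetUl.
    by exists Y; rewrite finset.subsetUr.
  have gU : g \in supp X :|: supp Y by apply: (fintype.subsetP PU); rewrite in_supp.
  have [N' [CN' N'e N'g N'U]] : exists N', [/\ C N', N' e != 0, g \notin supp N'
      & supp N' \subset supp X :|: supp Y].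
    have [Ng|Ng] := boolP (g \in supp N); last by exists N.
    have [||||||_ [[W CW <-] gW eW WU]] :=
      @matroid_strong_elimination _ _ _ _ hC (supp N) (supp P) g e; rewrite ?in_supp //.
    - by rewrite -in_supp.
    - by rewrite -in_supp.
    exists W; rewrite -in_supp; split=> //; apply: fintype.subset_trans WU _.
    by rewrite finset.subUset NU.
  have [W [CW eW gW WU]] : exists W, [/\ C W, e \notin supp W, g \notin supp W
      & supp W \subset supp X :|: supp Y].
    have [Rg|Rg] := boolP (g \in supp R); last by exists R.
    have [|||||_ [[W CW <-] gW WU]] :=
      @matroid_weak_elimination _ _ _ _ hC (supp P) (supp R) g; rewrite ?in_supp //.
    - by rewrite -in_supp.
    exists W; split=> //; last first.
      by apply: fintype.subset_trans WU _; rewrite finset.subUset PU.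
    by apply/negP => /(fintype.subsetP WU); rewrite finset.in_setU (negPf pP) (negPf pR).
  have [n ne N'n] := noloop N' CN' N'U; have [w we Ww] := noloop W CW WU.
  have QN' : Qs (supp (restr e N')).
    by exists (restr e N') => //; apply: contraction_circuit ne N'n.
  have sW : supp (restr e W) = supp (restr e N').
    apply: circuit_contraction_unique we Ww _ => // T QT TW.
    apply/eqP; apply: contraT => TN.
    have xT : x \notin T.
      apply: contra gW => /(fintype.subsetP TW).
      by rewrite in_supp ffunE xg -in_supp.
    have xN : x \notin supp (restr e N') by rewrite in_supp ffunE xg -in_supp.
    have := mod _ _ x QT QN' TN; rewrite (negPf xT) (negPf xN) UE xg gU /=; apply=> //.
      exact: fintype.subset_trans TW (subU _ WU).
    exact: subU.
  by have := eq_off_circuit CW CN' sW => E0; rewrite E0 in_supp N'e in eW.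
have [||Z [CZ Zf XYZ]] := el X Y (val f) CX CY modC.
- by move: XYf; rewrite -X'E -Y'E !ffunE.
- by move: Xf; rewrite -X'E ffunE.
have ZU := haddv_supp XYZ.
exists (restr e Z); split; last 1 first.
- by move=> x; rewrite -X'E -Y'E !ffunE; apply: XYZ.
- have [g ge Zg] := noloop Z CZ ZU.
  have [Z' [CZ' QZ' _ Z'Z]] := circuit_contraction_span hC CZ ge Zg.
  have S'Z : supp (restr e Z') \subset supp (restr e Z).
    apply: supp_sub => y; rewrite !ffunE -!lt0h => Zy.
    exact: lt_le_trans Zy (Z'Z _ (valP y)).
  have miss T : T \subset supp (restr e Z) -> f \notin T.
    by move=> TZ; apply/negP => /(fintype.subsetP TZ); rewrite in_supp ffunE Zf eqxx.
  have sZ : supp (restr e Z) = supp (restr e Z').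
    apply: circuit_contraction_unique ge Zg _ => // T QT TZ.
    apply/eqP; apply: contraT => TS; have QS : Qs (supp (restr e Z')).
      by exists (restr e Z').
    have := mod _ _ f QT QS TS; rewrite (negPf (miss _ TZ)) (negPf (miss _ S'Z)) /=.
    apply; [exact: fintype.subset_trans TZ (subU _ ZU)| |].
      exact: fintype.subset_trans S'Z (subU _ ZU).
    by rewrite finset.in_setU in_supp Xf.
  case: QZ' => _ nz minZ; split; [by exists Z| |by rewrite sZ].
  by move/eqP: nz; rewrite -supp_eq0 -sZ supp_eq0 => /eqP.
- by rewrite ffunE.
Qed.
End Contraction.

(** The hypothesis describes a loopless matroid of rank one, whose circuit supports are the pairs.
    Circuits through a base point [o] determine [Y] once it is 1 there; the content is consistency
    on the other pairs. *)
Lemma rank1_cocircuit (E : finType) (C : set {ffun E -> H}) : left_matroid C ->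
    min_sets (crossing_sets (circuits C)) [set: E]%SET ->
  exists2 Y : {ffun E -> H}, supp Y = [set: E]%SET & forall X, C X -> orthogonal X Y.
Proof.
move=> hC [crT T0 minT]; have [_ sc inc el] := hC.
have /set0Pn[o _] := T0; have we := matroid_weak_elimination hC.
have two A x : circuits C A -> x \in A -> exists2 y, y != x & y \in A.
  by move=> CA xA; have [y [yx yA _]] := crT A x CA xA (finset.in_setT x); exists y.
have two' A : circuits C A -> exists x y, [/\ x \in A, y \in A & y != x].
  case=> X CX <-; have [x Xx] := matroid_neq0 hC CX.
  have [||y yx yA] := two (supp X) x; [by exists X|by rewrite in_supp|].
  by exists x, y; rewrite in_supp.
have sub2 A a b : circuits C A -> A \subset [set a; b]%SET -> A = [set a; b]%SET.
  move=> CA sA; apply/eqP; rewrite finset.eqEsubset sA /=.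
  have [x [y [xA yA yx]]] := two' A CA; rewrite finset.subUset !finset.sub1set.
  have /set2P xE := fintype.subsetP sA x xA; have /set2P yE := fintype.subsetP sA y yA.
  by case: xE yE yx xA yA => [->|->] [->|->]; rewrite ?eqxx // => _ -> ->.
pose par a b := a != b -> circuits C [set a; b]%SET.
have par_sym a b : par a b -> par b a.
  by move=> h ba; rewrite finset.setUC; apply: h; rewrite eq_sym.
have par_trans a b c : par a b -> par b c -> par a c.
  move=> ab bc ac; have [ba|ba] := eqVneq a b; first by rewrite ba in ac *; apply: bc.
  have [cb|cb] := eqVneq b c; first by rewrite -cb; apply: ab.
  have [|||W [CW bW WU]] := we _ _ b (ab ba) (bc cb).
  - apply/eqP => /setP/(_ a); rewrite !inE eqxx (negPf ba) (negPf ac) //.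
  - by rewrite !inE eqxx orbT.
  - by rewrite !inE eqxx.
  have <- // := sub2 W a c CW; apply/fintype.subsetP => z zW.
  have := fintype.subsetP WU z zW; have : z != b by apply: contraNneq bW => <-.
  by rewrite !inE => /negPf-> /=; rewrite orbF.
have parT a : par o a.
  apply: contrapT => oa.
  (* A circuit meeting [S] only in [x] would have its other elements parallel to each other, hence
     be a pair, making [x] parallel to [o]. So [S] is a crossing set omitting [o], against
     minimality. *)
  pose S := [set a | `[< ~ par o a >]]%SET.
  have inS x : x \in S <-> ~ par o x by rewrite inE; split=> /asboolP.
  have S0 : S != finset.set0 by apply/set0Pn; exists a; apply/inS.
  have [|crS] := EM (crossing_sets (circuits C) S).
    move/minT => /(_ S0)/negP; apply; apply/fintype.properP; split=> //.
    by exists o; rewrite ?in_setT //; apply/negP => /inS; apply; rewrite /par eqxx.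
  apply: crS => A x CA xA /inS xS; apply: contrapT => no.
  have Apar y : y \in A -> y != x -> par o y.
    move=> yA yx; apply: contrapT => oy; apply: no; exists y; split=> //; exact/inS.
  have [y yx yA] := two A x CA xA; apply: xS; apply: (par_trans _ y); first exact: Apar.
  move=> _; suff <- : A = [set y; x]%SET by [].
  apply: sub2 => //; apply/fintype.subsetP => z zA; rewrite !inE.
  have [//|zy] := eqVneq z y; apply/eqP; apply: contrapT => /eqP zx.
  have yz : circuits C [set y; z]%SET.
    apply: (par_trans _ o); [exact/par_sym/Apar|exact: Apar|by rewrite eq_sym].
  have /setP/(_ x) : [set y; z]%SET = A.
    by apply: (matroid_antichain hC) => //; rewrite finset.subUset !finset.sub1set yA.
  by rewrite !inE xA eq_sym (negPf yx) eq_sym (negPf zx).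
have allpar a b : par a b by apply: (par_trans _ o) => //; apply: par_sym.
have pick f : exists X, f != o -> C X /\ supp X = [set o; f]%SET.
  have [->|of_] := eqVneq f o; first by exists (zerov H E).
  by have [|X CX sX] := allpar o f; [rewrite eq_sym|exists X].
have [P PP] := choice pick.
have Pf f : f != o -> P f f != 0.
  by move=> /PP[_ sP]; rewrite -in_supp sP !inE eqxx orbT.
have Po f : f != o -> P f o != 0.
  by move=> /PP[_ sP]; rewrite -in_supp sP !inE eqxx.
pose Y : {ffun E -> H} := [ffun f => if f == o then hone H else hinv (P f f) ** P f o].
have Yo : Y o = hone H by rewrite ffunE eqxx.
have Yf f : f != o -> P f f ** Y f = P f o.
  by move=> fo; rewrite ffunE (negPf fo) hmulA hmulV ?hmul1l // Pf.
have sY : supp Y = [set: E]%SET.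
  apply/setP => f; rewrite in_supp ffunE finset.in_setT.
  have [_|fo] := eqVneq f o; first exact: hone_neq0.
  by rewrite hmul_neq0 hinv_neq0 ?Pf ?Po.
have Xo X a : C X -> a != o -> supp X = [set o; a]%SET -> X a ** Y a = X o ** Y o.
  move=> CX ao sX; have [CP sP] := PP a ao.
  have [|c c0 ->] := inc (P a) X CP CX; first by rewrite sX sP.
  by rewrite [lscale _ _ a]ffunE [lscale _ _ o]ffunE -!hmulA Yf // Yo hmul1r.
(* Away from [o], eliminating [o] from the circuits on [o, a] and [o, b], normalised at [o], gives a
   circuit on [a, b], which is proportional to [X]. *)
have Xab X a b : C X -> a != b -> supp X = [set a; b]%SET -> X a ** Y a = X b ** Y b.
  move=> CX ab sX; have [ao|ao] := eqVneq a o.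
    by subst a; rewrite [RHS]Xo // eq_sym.
  have [bo|bo] := eqVneq b o.
    by subst b; apply: Xo => //; rewrite sX finset.setUC.
  have [[CPa sPa] [CPb sPb]] := (PP a ao, PP b bo).
  have [ia ib] := (hinv_neq0 (Po a ao), hinv_neq0 (Po b bo)).
  pose Xa := lscale (hinv (P a o)) (P a); pose Xb := lscale (hinv (P b o)) (P b).
  have mod : modular_pair (circuits C) (supp Xa) (supp Xb).
    rewrite !supp_lscale // sPa sPb; split.
      by apply/eqP => /setP/(_ a); rewrite !inE eqxx orbT (negPf ao) (negPf ab).
    move=> A B CA CB AB; apply: contra AB => /proper_card lt.
    have card2 A' : circuits C A' -> (1 < #|A'|)%N.
      by move=> /two'[x [y [xA yA yx]]]; rewrite (cardD1 x) xA (cardD1 y) !inE yx yA.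
    have le2 : (#|A :|: B| <= 2)%N.
      rewrite -ltnS; apply: leq_trans lt _; rewrite -finset.setUUr.
      by rewrite cardsU1 cards2; case: (_ \notin _); case: (_ != _).
    have full A' : circuits C A' -> A' \subset A :|: B -> A' = A :|: B.
      by move=> /card2 c sA; apply/eqP; rewrite eqEcard sA; apply: leq_trans le2 c.
    rewrite (full A CA (finset.subsetUl _ _)) eq_sym.
    by rewrite -{1}(full B CB (finset.subsetUr _ _)) eqxx.
  have [||Z [CZ Zo XZ]] := el Xa Xb o (sc _ _ CPa ia) (sc _ _ CPb ib) mod.
  - by rewrite !ffunE !hmulVl ?Po.
  - by rewrite ffunE hmulVl ?Po // hone_neq0.
  have Pab : P a b = 0.
    apply/eqP; rewrite -[_ == _]negbK -in_supp sPa !inE (negPf bo) /= eq_sym.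
    by rewrite (negPf ab).
  have Pba : P b a = 0.
    by apply/eqP; rewrite -[_ == _]negbK -in_supp sPb !inE (negPf ao) /= (negPf ab).
  have Za : Z a = Xa a.
    by have := XZ a; rewrite [Xb a]ffunE Pba hmul0r hadd0.
  have Zb : Z b = Xb b.
    by have := XZ b; rewrite [Xa b]ffunE Pab hmul0r haddC hadd0.
  have [|c c0 ->] := inc Z X CZ CX.
    rewrite sX; apply/fintype.subsetP => z zZ; have := fintype.subsetP (haddv_supp XZ) z zZ.
    rewrite !supp_lscale // sPa sPb !inE.
    have [zo|_] := eqVneq z o; last by rewrite /=.
    by rewrite zo in_supp Zo eqxx in zZ.
  rewrite [lscale _ _ a]ffunE [lscale _ _ b]ffunE Za Zb [Xa a]ffunE [Xb b]ffunE.
  by rewrite -!hmulA !Yf // !hmulVl // Po.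
exists Y => // X CX; apply/orthogonalP => f nz.
have Xf : f \in supp X by move: nz; rewrite in_supp hmul_neq0 => /andP[].
have [||g gf Xg] := two (supp X) f; [by exists X|by []|].
have sX : supp X = [set g; f]%SET.
  apply/esym; apply: (matroid_antichain hC); [exact: allpar|by exists X|].
  by rewrite finset.subUset !finset.sub1set Xg.
by exists g => //; rewrite (Xab X g f).
Qed.

Lemma cocircuit_exists (E : finType) (C : set {ffun E -> H}) (K : {set E}) :
    left_matroid C -> min_sets (crossing_sets (circuits C)) K ->
  exists2 Y : {ffun E -> H}, supp Y = K & forall X, C X -> orthogonal X Y.
Proof.
have [n] := ubnP #|E|; elim: n E C K => // n IH E C K lt hC minK.
have [KT|/fintype.subsetPn[e _ eK]] := boolP ([set: E]%SET \subset K).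
  move: minK; have -> : K = [set: E]%SET.
    by apply/eqP; rewrite finset.eqEsubset finset.subsetT.
  exact: rank1_cocircuit.
have [crK K0 mK] := minK; pose K' := [set x : del e | val x \in K]%SET.
have neK f : f \in K -> f != e by move=> fK; apply: contraNneq eK => <-.
have [||Y' sY' orthY'] := IH (del e) (contraction C e) K' _ (contraction_left_matroid hC e).
- rewrite card_sig; apply: leq_trans (_ : #|E| <= n)%N; last by rewrite -ltnS.
  rewrite [ltnRHS](cardD1 e) ltnS; apply: subset_leq_card.
  by apply/fintype.subsetP => x; rewrite !inE andbT.
- split.
  + move=> _ x [_ [[X CX <-] _ _] <-]; rewrite in_supp ffunE inE => Xx xK.
    have [||y [yx yX yK]] := crK (supp X) (val x) _ _ xK; [by exists X|by rewrite in_supp|].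
    have [y' yE] := ex_del (neK y yK); subst y; exists y'; split; [by []| |by rewrite inE].
    by move: yX; rewrite !in_supp ffunE.
  + have /set0Pn[z zK] := K0; have [x xz] := ex_del (neK z zK).
    by apply/set0Pn; exists x; rewrite inE xz.
  move=> B crB B0; apply/negP => /fintype.properP[/fintype.subsetP BK [x xK xB]].
  pose B' := [set val y | y in B]%SET.
  have inB' (y : del e) : (val y \in B') = (y \in B) by rewrite mem_imset //; apply: val_inj.
  (* Below any circuit meeting [B'] at [z] lies a contraction circuit through [z], so crossing sets
     of the contraction are crossing sets of [C] and [K] stays minimal. *)
  have crB' : crossing_sets (circuits C) B'.
    move=> _ z [X CX <-] Xz /imsetP[y yB zE]; subst z; rewrite in_supp in Xz.
    have [Z [CZ QZ Zy ZX]] := circuit_contraction_span hC CX (valP y) Xz.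
    have [|||w [wy wZ wB]] := crB (supp (restr e Z)) y; rewrite ?in_supp ?ffunE ?Zy //.
    exists (val w); rewrite inB' wB val_eqE wy; split=> //.
    rewrite in_supp -lt0h; apply: lt_le_trans (ZX _ (valP w)).
    by move: wZ; rewrite in_supp ffunE lt0h.
  have B'0 : B' != finset.set0.
    by have /set0Pn[y yB] := B0; apply/set0Pn; exists (val y); rewrite inB'.
  have := mK B' crB' B'0; case/negP; apply/fintype.properP; split.
    by apply/fintype.subsetP => _ /imsetP[y /BK yK ->]; rewrite inE in yK.
  by exists (val x); rewrite ?inB' //; rewrite inE in xK.
pose Y : {ffun E -> H} := [ffun f => if insub f is Some x then Y' x else 0].
have Ye : Y e = 0 by rewrite ffunE insubF // eqxx.
have Yx (x : del e) : Y (val x) = Y' x by rewrite ffunE valK.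
exists Y.
  apply/setP => f; have [->|/ex_del[x <-]] := eqVneq f e.
    by rewrite in_supp Ye eqxx (negPf eK).
  by rewrite in_supp Yx -in_supp sY' inE.
move=> X CX; apply/(@orthogonal_restr _ _ _ e); first by rewrite Ye hmul0r.
have -> : restr e Y = Y' by apply/ffunP => x; rewrite ffunE Yx.
apply: span_orthogonal orthY' => x; rewrite ffunE => Xx.
have [Z [CZ QZ Zx ZX]] := circuit_contraction_span hC CX (valP x) Xx.
exists (restr e Z); split=> // [|y]; first by rewrite ffunE Zx.
by rewrite !ffunE; apply: ZX; apply: (valP y).
Qed.

Lemma left_matroid_dual_pair (E : finType) (C : set {ffun E -> H}) :
  left_matroid C -> exists D, dual_pair C D.
Proof.
move=> hC; have [C0 sc _ _] := hC.
pose Ks := min_sets (crossing_sets (circuits C)).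
(* Taking all orthogonal vectors on cocircuit supports gives closure under right scaling;
   [cocircuit_exists] ensures that each support occurs. *)
pose D := [set Y : {ffun E -> H} | Ks (supp Y) /\ forall X, C X -> orthogonal X Y].
have sD : circuits D = Ks.
  apply/seteqP; split=> [_ [Y [KY _] <-]//|K KK].
  by have [Y sY orthY] := cocircuit_exists hC KK; exists Y; rewrite //=; split; rewrite ?sY.
exists D; split=> //.
- by case=> -[_ + _] _; rewrite supp_eq0 eqxx.
- move=> Y a [KY orthY] a0; split; first by rewrite supp_rscale.
  by move=> X CX; apply/orthogonal_rscale/orthY.
- by rewrite sD; apply: min_sets_antichain.
- by rewrite sD; apply/elimination_painting/matroid_strong_elimination.
- by move=> X Y CX [_ orthY]; apply: orthY.
Qed.

End Duality.

Theorem theorem23 (d : Order.disp_t) (Gamma : orderedGroupType d) (E : finType)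
    (M : set {ffun E -> Gmax Gamma}) (hM : left_matroid M) (e : E) :
  vectors (contraction M e) = proj (vectors M) e /\
  vectors (deletion M e) = slice (vectors M) e.
Proof.
have [D MD] := left_matroid_dual_pair hM.
by split; [apply: vectors_contraction MD|apply: vectors_deletion MD].
Qed.
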